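(* Let $G$ be a finite group, let $A$ be an infinite-dimensional stably finite simple unital C*-algebra, let $\alpha \colon G \to \operatorname{Aut}(A)$ be an action of $G$ on $A$ which has the weak tracial Rokhlin property, and let $\tau\in\operatorname{QT}\bigl(C^*(G,A,\alpha)\bigr)$. Let $p = \frac{1}{\operatorname{card}(G)}\sum_{g\in G}u_g \in C^*(G,A,\alpha)$, where $u_g$ is the standard unitary in the crossed product corresponding to $g\in G$. Then $\tau(p) = \frac{1}{\operatorname{card}(G)}$.
   Context: In the crossed product $C^*(G,A,\alpha)$, the unitaries $u_g$ satisfy $u_g a u_g^* = \alpha_g(a)$ for $a\in A$. Weak tracial Rokhlin property: with $M_\infty(A) = \bigcup_n M_n(A)$, for $a,b \in M_\infty(A)_+$ write $a \precsim_A b$ if there is a sequence $(v_n)$ in $M_\infty(A)$ with $\lim_n v_n b v_n^* = a$. An action $\alpha$ of a finite group $G$ on a simple unital C*-algebra $A$ has the weak tracial Rokhlin property if for every $\varepsilon>0$, every finite set $F \subseteq A$, and every positive $x \in A$ with $\|x\|=1$, there exist orthogonal positive contractions $f_g \in A$ for $g \in G$ such that, with $f = \sum_{g\in G} f_g$: (1) $\|a f_g - f_g a\| < \varepsilon$ for all $g \in G$, $a \in F$; (2) $\|\alpha_g(f_h) - f_{gh}\| < \varepsilon$ for all $g,h \in G$; (3) $1 - f \precsim_A x$; (4) $\|f x f\| > 1 - \varepsilon$. Quasitraces: a function $\tau\colon B \to \mathbb{C}$ on a C*-algebra $B$ is a quasitrace if (i) $\tau(x^*x) = \tau(xx^* )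 \ge 0$ for all $x\in B$; (ii) $\tau(a+ib) = \tau(a)+i\tau(b)$ for selfadjoint $a,b\in B$; (iii) $\tau|_C$ is linear for every commutative C*-subalgebra $C \subseteq B$; (iv) there is a function $\tau_2 \colon M_2(B) \to \mathbb{C}$ satisfying (i)–(iii) on $M_2(B)$ with $\tau(x) = \tau_2(x \otimes e_{1,1})$ for all $x \in B$. For unital $B$, $\operatorname{QT}(B)$ is the set of quasitraces with $\tau(1)=1$. *)

(* Defs.v *)
From HB Require Import structures.
From mathcomp Require Import all_boot all_order all_algebra all_fingroup.
From mathcomp Require Import complex.
From mathcomp Require Import all_classical all_reals all_analysis.

Set Implicit Arguments.
Unset Strict Implicit.
Unset Printing Implicit Defensive.

Import Order.TTheory GRing.Theory Num.Theory.
Import numFieldNormedType.Exports.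

Local Open Scope classical_set_scope.
Local Open Scope ring_scope.
Local Open Scope complex_scope.

(* Unital complex C*-algebras.  The complex numbers are R[i] for R : realType,
   and the norm of an element is an R[i]-valued nonnegative (hence real)
   number.
   The hierarchy has no join of rings with normed modules (numDomainType would
   have to inherit from it), so the multiplication is part of the mixin and the
   algebra structure is declared on the resulting type afterwards. *)
HB.mixin Record isCStar (R : realType) A & CompleteNormedModule R[i] A := {
  cstar_one : A;
  cstar_mul : A -> A -> A;
  star : A -> A;
  cstar_mulA : associative cstar_mul;
  cstar_mul1l : left_id cstar_one cstar_mul;
  cstar_mul1r : right_id cstar_one cstar_mul;
  cstar_mulDl : left_distributive cstar_mul +%R;
  cstar_mulDr : right_distributive cstar_mul +%R;
  cstar_one_neq0 : cstar_one != 0;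
  cstar_scaleAl : forall (c : R[i]) x y,
    c *: cstar_mul x y = cstar_mul (c *: x) y;
  cstar_scaleAr : forall (c : R[i]) x y,
    c *: cstar_mul x y = cstar_mul x (c *: y);
  starK : involutive star;
  starD : forall x y, star (x + y) = star x + star y;
  starZ : forall (c : R[i]) x, star (c *: x) = conjc c *: star x;
  starM : forall x y, star (cstar_mul x y) = cstar_mul (star y) (star x);
  ler_cstar_norm_mul : forall x y, `|cstar_mul x y| <= `|x| * `|y| :> R[i];
  cstar_norm_star_mul : forall x, `|cstar_mul (star x) x| = `|x| ^+ 2 :> R[i]
}.

#[short(type="cstarAlgType")]
HB.structure Definition CStarAlgebra (R : realType) :=
  {A of CompleteNormedModule R[i] A & isCStar R A}.

HB.instance Definition _ (R : realType) (A : cstarAlgType R) :=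
  GRing.Zmodule_isNzRing.Build (CStarAlgebra.sort A)
    (@cstar_mulA R A) (@cstar_mul1l R A) (@cstar_mul1r R A)
    (@cstar_mulDl R A) (@cstar_mulDr R A) (@cstar_one_neq0 R A).

HB.instance Definition _ (R : realType) (A : cstarAlgType R) :=
  GRing.Lmodule_isLalgebra.Build R[i] (CStarAlgebra.sort A)
    (@cstar_scaleAl R A).

HB.instance Definition _ (R : realType) (A : cstarAlgType R) :=
  GRing.Lalgebra_isAlgebra.Build R[i] (CStarAlgebra.sort A)
    (@cstar_scaleAr R A).

Section CStarBasics.
Variable R : realType.
Implicit Types A B : cstarAlgType R.

Definition positive A (a : A) : Prop := exists b : A, a = star b * b.

Definition unitary A (w : A) : Prop := star w * w = 1 /\ w * star w = 1.

Definition infinite_dimensional A : Prop :=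
  ~ exists (n : nat) (e : 'I_n -> A),
      forall a : A, exists c : 'I_n -> R[i], a = \sum_i c i *: e i.

Definition closed_ideal A (I : set A) : Prop :=
  [/\ closed I, I 0,
      forall x y, I x -> I y -> I (x + y)
    & forall a x, I x -> I (a * x) /\ I (x * a)].

Definition simple_cstar A : Prop :=
  forall I : set A, closed_ideal I -> I = [set 0] \/ I = [set: A].

Definition star_preserving A B (f : A -> B) : Prop :=
  forall a, f (star a) = star (f a).

End CStarBasics.

Section MatrixAlgebras.
Variables (R : realType) (A : cstarAlgType R).

Definition mxstar (n : nat) (M : 'M[A]_n) : 'M[A]_n := map_mx star M^T.

(* Norm of the right Hilbert A-module A^n. *)
Definition hnorm (n : nat) (xi : 'cV[A]_n) : R :=
  Num.sqrt (complex.Re `|\sum_i star (xi i 0) * xi i 0|).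

(* The C*-norm of M_n(A): the operator norm of M_n(A) acting on the Hilbert
   module A^n. *)
Definition mxnorm (n : nat) (M : 'M[A]_n) : R :=
  sup [set hnorm (M *m xi) | xi in [set xi : 'cV[A]_n | hnorm xi <= 1]].

Definition stably_finite : Prop :=
  forall (n : nat) (v : 'M[A]_n),
    mxstar v *m v = 1%:M -> v *m mxstar v = 1%:M.

(* The zero-padding embedding of M_m(A) into M_k(A), used for m <= k. *)
Definition pad (m k : nat) (a : 'M[A]_m) : 'M[A]_k :=
  \matrix_(i < k, j < k)
    if insub (val i) is Some i' then
      if insub (val j) is Some j' then a i' j' else 0
    else 0.

(* v_n ranges over the union M_oo(A) of the M_k(A), so its size k n may depend
   on n; a and b are padded to that size, which may be taken to be at least
   that of a and of b. *)
Definition cuntz_le (m l : nat) (a : 'M[A]_m) (b : 'M[A]_l) : Prop :=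
  exists (k : nat -> nat) (v : forall n, 'M[A]_(k n)),
    (forall n, (m <= k n)%N /\ (l <= k n)%N) /\
    (fun n => mxnorm (v n *m pad (k n) b *m mxstar (v n) - pad (k n) a))
      @ \oo --> (0 : R).

End MatrixAlgebras.

Section Actions.
Variables (R : realType) (G : finGroupType) (A : cstarAlgType R).

Definition cstar_action (alpha : G -> {lrmorphism A -> A}) : Prop :=
  (forall g, star_preserving (alpha g) /\ bijective (alpha g)) /\
  (forall g h a, alpha (g * h)%g a = alpha g (alpha h a)).

Definition weak_tracial_Rokhlin (alpha : G -> {lrmorphism A -> A}) : Prop :=
  forall (eps : R) (F : set A) (x : A),
    0 < eps -> finite_set F -> positive x -> `|x| = 1 ->
  exists f_ : G -> A,
    [/\ forall g, positive (f_ g) /\ `|f_ g| <= 1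
      & forall g h, g != h -> f_ g * f_ h = 0] /\
    let f := \sum_g f_ g in
    [/\ forall g a, F a -> `|a * f_ g - f_ g * a| < eps%:C,
        forall g h, `|alpha g (f_ h) - f_ (g * h)%g| < eps%:C,
        cuntz_le ((1 - f)%:M : 'M[A]_1) (x%:M : 'M[A]_1)
      & `|f * x * f| > 1 - eps%:C].

Definition covariant_pair (alpha : G -> {lrmorphism A -> A})
    (D : cstarAlgType R) (pi : {lrmorphism A -> D}) (w : G -> D) : Prop :=
  [/\ star_preserving pi,
      forall g, unitary (w g),
      forall g h, w (g * h)%g = w g * w h
    & forall g a, w g * pi a * star (w g) = pi (alpha g a)].

(* B, with the canonical map iota of A and the standard unitaries u_g, is
   C^*(G, A, alpha): a covariant pair generating B through which every
   covariant pair factors.  As G is finite and A is unital, B and all the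
   covariant pairs may be taken unital. *)
Definition is_crossed_product (alpha : G -> {lrmorphism A -> A})
    (B : cstarAlgType R) (iota : {lrmorphism A -> B}) (u : G -> B) : Prop :=
  [/\ covariant_pair alpha iota u,
      closure [set \sum_g iota (a g) * u g | a in [set: G -> A]] = [set: B]
    & forall (D : cstarAlgType R) (pi : {lrmorphism A -> D}) (w : G -> D),
        covariant_pair alpha pi w ->
        exists Phi : {lrmorphism B -> D},
          [/\ star_preserving Phi,
              forall a, Phi (iota a) = pi a
            & forall g, Phi (u g) = w g]].

End Actions.

(* Conditions (i)-(iii) below are used both for B and for M_2(B), so they are
   stated for a ring T with an involution st, a scalar multiplication sc and a
   notion cl of closed subset. *)
Section Quasitraces.
Variable R : realType.

Section Generic.
Variables (T : nzRingType) (st : T -> T) (sc : R[i] -> T -> T).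
Variable cl : set T -> Prop.

Definition commutative_cstar_subalgebra (S : set T) : Prop :=
  [/\ cl S,
      S 0 /\ (forall x y, S x -> S y -> S (x + y)),
      (forall c x, S x -> S (sc c x)) /\ (forall x, S x -> S (st x)),
      forall x y, S x -> S y -> S (x * y)
    & forall x y, S x -> S y -> x * y = y * x].

Definition one_quasitrace (tau : T -> R[i]) : Prop :=
  [/\ forall x, tau (st x * x) = tau (x * st x) /\ 0 <= tau (st x * x),
      forall a b, st a = a -> st b = b ->
        tau (a + sc 'i b) = tau a + 'i * tau b
    & forall S, commutative_cstar_subalgebra S ->
        forall c x y, S x -> S y -> tau (sc c x + y) = c * tau x + tau y].

End Generic.

Variable B : cstarAlgType R.

(* [closed] on 'M[B]_2 refers to entrywise convergence, which is the topology
   of the C*-norm of M_2(B). *)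
Definition quasitrace (tau : B -> R[i]) : Prop :=
  one_quasitrace (@star R B) *:%R closed tau /\
  exists tau2 : 'M[B]_2 -> R[i],
    one_quasitrace (@mxstar R B 2) (fun c => map_mx ( *:%R c)) closed tau2 /\
    forall x : B, tau x = tau2 (x *: delta_mx 0 0).

Definition QT : set (B -> R[i]) := [set tau | quasitrace tau /\ tau 1 = 1].

End Quasitraces.

Arguments QT {R} B _.

(* Main.v *)
Require Import Defs.
From mathcomp Require Import all_boot all_order all_algebra all_fingroup.
From mathcomp Require Import complex.
From mathcomp Require Import all_classical all_reals all_analysis.
From mathcomp Require Import ring lra.

(** Write [n] for the order of [G], [u_g] for the unitaries, [E = 1 - f] for the
    remainder of a Rokhlin family [f_g], and [F = sum_g f_g^2 = f^2]. For
    [e = f_1], the elements [e p e] and [p e^2 p] have equal quasitraces. The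
    first is close to [e^2 / n] because [e u_g e] is close to [e f_g u_g = 0] for
    [g <> 1], the second to [p F p / n] by averaging over [G]. Hence
    [tau (p F p)] is close to [tau (e^2)], which is close to [tau F / n]. Since
    [p F p] commutes with [p], it remains to make [tau (1 - F)] and
    [tau (p (1 - F) p)] small. Both are controlled by [tau E] and [tau (p E p)],
    and [E] is a limit of elements [v x v^*], where [x] may be chosen with a local
    unit [h] such that [tau (h^2)] is small: repeated splitting produces many
    orthogonal such [h], as [A] is simple and infinite-dimensional.

    As a quasitrace is linear only on commutative subalgebras, the comparison of
    nearby elements rests on its monotonicity. For [0 <= a <= b], the functions
    [(a - k s)_+ - (a - (k+1) s)_+] add up to [a], and each of them is dominated
    by some [x^* x] with [x] supported on [b >= (k-1) s], so that a polar
    decomposition compares it with a slightly lower layer of [b]. *)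

Import Order.TTheory GRing.Theory Num.Theory.
Import numFieldNormedType.Exports.
Local Open Scope classical_set_scope.
Local Open Scope ring_scope.
Local Open Scope complex_scope.

Set Implicit Arguments.
Unset Strict Implicit.
Unset Printing Implicit Defensive.

(** * Identities in noncommutative rings *)

(** Reified ring expressions, normalized to lists of signed words in the atoms. This serves
    identities that hold in every noncommutative ring. *)
Inductive ncexpr :=
  | NcVar of nat | Nc0 | Nc1
  | NcAdd of ncexpr & ncexpr | NcOpp of ncexpr | NcMul of ncexpr & ncexpr.

Section NcRing.
Variables (K : nzRingType) (env : seq K).

Fixpoint nc_eval (e : ncexpr) : K :=
  match e with
  | NcVar n => nth 0 env n | Nc0 => 0 | Nc1 => 1
  | NcAdd a b => nc_eval a + nc_eval b
  | NcOpp a => - nc_eval a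
  | NcMul a b => nc_eval a * nc_eval b
  end.

Definition nc_mono (m : seq nat) : K := foldr (fun n r => nth 0 env n * r) 1 m.
Definition nc_term (t : bool * seq nat) : K :=
  if t.1 then - nc_mono t.2 else nc_mono t.2.
Definition nc_poly (l : seq (bool * seq nat)) : K :=
  foldr (fun t r => nc_term t + r) 0 l.

(** A word cancels against an opposite one at insertion, so a formally vanishing expression
    normalizes to the empty list without any sorting. *)
Definition nc_ins (t : bool * seq nat) (l : seq (bool * seq nat)) :=
  if (~~ t.1, t.2) \in l then rem (~~ t.1, t.2) l else t :: l.

Fixpoint nc_norm (e : ncexpr) : seq (bool * seq nat) :=
  match e with
  | NcVar n => [:: (false, [:: n])] | Nc0 => [::] | Nc1 => [:: (false, [::])]
  | NcAdd a b => foldr nc_ins (nc_norm b) (nc_norm a)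
  | NcOpp a => [seq (~~ t.1, t.2) | t <- nc_norm a]
  | NcMul a b =>
      foldr (fun t l => foldr (fun s l' => nc_ins (t.1 (+) s.1, t.2 ++ s.2) l')
                              l (nc_norm b)) [::] (nc_norm a)
  end.

Lemma nc_poly_ins t l : nc_poly (nc_ins t l) = nc_term t + nc_poly l.
Proof.
rewrite /nc_ins; case: ifP => // hin.
have -> : nc_poly l = nc_term (~~ t.1, t.2) + nc_poly (rem (~~ t.1, t.2) l).
  elim: l hin => //= s l IH; rewrite inE; case: eqVneq => [<- //| ne /= hin].
  by rewrite (IH hin) !addrA [_ s + _]addrC.
by rewrite addrA /nc_term; case: t.1 => /=; rewrite ?addNr ?subrr add0r.
Qed.

Lemma nc_mono_cat m m' : nc_mono (m ++ m') = nc_mono m * nc_mono m'.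
Proof. by elim: m => [|n m IH] /=; rewrite ?mul1r // IH mulrA. Qed.

Lemma nc_normE e : nc_eval e = nc_poly (nc_norm e).
Proof.
elim: e => [n|||a ha b hb|a ha|a ha b hb] /=; rewrite ?ha ?hb.
- by rewrite /nc_term /= mulr1 addr0.
- by [].
- by rewrite /nc_term /= addr0.
- elim: (nc_norm a) => [|t l IH] /=; first by rewrite add0r.
  by rewrite nc_poly_ins -IH addrA.
- elim: (nc_norm a) => [|t l IH] /=; first by rewrite oppr0.
  by rewrite opprD IH /nc_term; case: t.1 => /=; rewrite ?opprK.
- elim: (nc_norm a) => [|t l IH] /=; first by rewrite mul0r.
  rewrite mulrDl {}IH; move: (foldr _ _ l) => r.
  elim: (nc_norm b) => [|s l' IH'] /=; first by rewrite mulr0 add0r.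
  rewrite nc_poly_ins -IH' mulrDr addrA; congr (_ + _ + _).
  rewrite /nc_term /= nc_mono_cat.
  by case: t.1; case: s.1; rewrite /= ?mulrNN ?mulrN ?mulNr.
Qed.

Lemma nc_ring_correct a b :
  nc_norm (NcAdd a (NcOpp b)) = [::] -> nc_eval a = nc_eval b.
Proof.
move=> h; apply/eqP; rewrite -subr_eq0.
by have := nc_normE (NcAdd a (NcOpp b)); rewrite h /= => ->.
Qed.

End NcRing.

Ltac nc_find x l :=
  lazymatch l with
  | x :: _ => constr:(0%N)
  | _ :: ?l' => let n := nc_find x l' in constr:(S n)
  end.
Ltac nc_mem x l :=
  lazymatch l with
  | x :: _ => constr:(true)
  | _ :: ?l' => nc_mem x l'
  | _ => constr:(false)
  end.
Ltac nc_atoms t l :=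
  lazymatch t with
  | (?a + ?b)%R => let l1 := nc_atoms a l in nc_atoms b l1
  | (- ?a)%R => nc_atoms a l
  | (?a * ?b)%R => let l1 := nc_atoms a l in nc_atoms b l1
  | 0%R => l
  | 1%R => l
  | _ => lazymatch nc_mem t l with
         | true => l
         | false => constr:(t :: l)
         end
  end.
Ltac nc_reify t l :=
  lazymatch t with
  | (?a + ?b)%R =>
      let x := nc_reify a l in let y := nc_reify b l in constr:(NcAdd x y)
  | (- ?a)%R => let x := nc_reify a l in constr:(NcOpp x)
  | (?a * ?b)%R =>
      let x := nc_reify a l in let y := nc_reify b l in constr:(NcMul x y)
  | 0%R => constr:(Nc0)
  | 1%R => constr:(Nc1)
  | _ => let n := nc_find t l in constr:(NcVar n)
  end.
Ltac nc_ring :=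
  rewrite ?expr2 ?mulr2n ?scaleNr;
  lazymatch goal with
  | |- ?a = ?b =>
      let K := type of a in
      let l1 := nc_atoms a (@nil K) in
      let l := nc_atoms b l1 in
      let x := nc_reify a l in
      let y := nc_reify b l in
      exact: (@nc_ring_correct _ l x y erefl)
  end.

(** * Norms and limits *)

Section NormBasics.
Variables (R : realType) (A : cstarAlgType R).
Implicit Types (x y z a b : A) (r s t e : R).

Definition nrm (x : A) : R := complex.Re `|x|.

Lemma nrmE x : `|x| = (nrm x)%:C.
Proof. by rewrite /nrm RRe_real // normr_real. Qed.

Lemma nrm_ge0 x : 0 <= nrm x.
Proof. by rewrite -ler0c -nrmE. Qed.

Lemma nrm0 : nrm 0 = 0.
Proof. by rewrite /nrm normr0. Qed.

Lemma nrm_eq0 x : nrm x <= 0 -> x = 0.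
Proof.
move=> h; apply/eqP; rewrite -normr_eq0 nrmE.
by have/le_anti -> : nrm x <= 0 <= nrm x by rewrite h nrm_ge0.
Qed.

Lemma nrmD x y : nrm (x + y) <= nrm x + nrm y.
Proof. by rewrite -lecR rmorphD /= -!nrmE ler_normD. Qed.

Lemma nrmN x : nrm (- x) = nrm x.
Proof. by rewrite /nrm normrN. Qed.

Lemma nrm_subC x y : nrm (x - y) = nrm (y - x).
Proof. by rewrite -nrmN opprB. Qed.

Lemma nrmM x y : nrm (x * y) <= nrm x * nrm y.
Proof. by rewrite -lecR rmorphM /= -!nrmE; exact: ler_cstar_norm_mul. Qed.

Lemma nrmZC (c : R[i]) x : nrm (c *: x) = ComplexField.Normc.normc c * nrm x.
Proof. by rewrite /nrm normrZ nrmE /= mul0r subr0. Qed.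

Lemma nrmZ r x : nrm (r%:C *: x) = `|r| * nrm x.
Proof. by rewrite nrmZC /= expr0n addr0 sqrtr_sqr. Qed.

Lemma nrm_starM x : nrm (star x * x) = nrm x ^+ 2.
Proof.
by apply: complexI; rewrite rmorphXn /= -!nrmE; exact: cstar_norm_star_mul.
Qed.

Lemma starMr x y : star (x * y) = star y * star x.
Proof. exact: starM. Qed.

Lemma star0 : star (0 : A) = 0.
Proof. by apply: (addrI (star 0)); rewrite -starD !addr0. Qed.

Lemma starN x : star (- x) = - star x.
Proof. by apply/eqP; rewrite -addr_eq0 -starD addNr star0. Qed.

Lemma starB x y : star (x - y) = star x - star y.
Proof. by rewrite starD starN. Qed.

Lemma star1 : star (1 : A) = 1.
Proof. by rewrite -[LHS]mul1r -[X in X * _]starK -starMr mul1r starK. Qed.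

Lemma starZr r x : star (r%:C *: x) = r%:C *: star x.
Proof. by rewrite starZ conjc_real. Qed.

Lemma star_sum (I : Type) (l : seq I) (P : pred I) (F : I -> A) :
  star (\sum_(i <- l | P i) F i) = \sum_(i <- l | P i) star (F i).
Proof. exact: (big_morph _ starD star0). Qed.

Lemma nrm_star x : nrm (star x) = nrm x.
Proof.
suff h y : nrm y <= nrm (star y) by apply/le_anti; rewrite h -{2}(starK x) h.
case: (ltrP 0 (nrm y)) => [y0|/le_trans->//]; last exact: nrm_ge0.
rewrite -(ler_pM2r y0) -expr2 -nrm_starM; exact: nrmM.
Qed.

Lemma nrm_sa x : star x = x -> nrm (x * x) = nrm x ^+ 2.
Proof. by move=> sx; rewrite -nrm_starM sx. Qed.

Lemma nrm1 : nrm 1 = 1.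
Proof.
have := nrm_sa star1; rewrite mulr1 expr2 => h.
have n0 : nrm 1 != 0.
  by apply/eqP => h0; move/eqP: (@cstar_one_neq0 R A); apply; apply: nrm_eq0; rewrite h0.
by apply: (mulfI n0); rewrite -h mulr1.
Qed.

(** Real scalars are made elements of the algebra, so that [nc_ring] meets products only and no
    scalar multiplication. *)
Definition rsc (r : R) : A := r%:C *: 1.

Lemma rscE r x : r%:C *: x = rsc r * x.
Proof. by rewrite /rsc -scalerAl mul1r. Qed.

Lemma rscC r x : rsc r * x = x * rsc r.
Proof. by rewrite /rsc -scalerAl -scalerAr mul1r mulr1. Qed.

Lemma rscD r s : rsc (r + s) = rsc r + rsc s.
Proof. by rewrite /rsc rmorphD scalerDl. Qed.
Lemma rscN r : rsc (- r) = - rsc r.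
Proof. by rewrite /rsc rmorphN scaleNr. Qed.
Lemma rscM r s : rsc (r * s) = rsc r * rsc s.
Proof. by rewrite -rscE /rsc scalerA rmorphM. Qed.
Lemma rsc1 : rsc 1 = 1. Proof. by rewrite /rsc scale1r. Qed.
Lemma rsc0 : rsc 0 = 0. Proof. by rewrite /rsc scale0r. Qed.
Lemma star_rsc r : star (rsc r) = rsc r.
Proof. by rewrite /rsc starZr star1. Qed.
Lemma nrm_rsc r : nrm (rsc r) = `|r|.
Proof. by rewrite /rsc nrmZ nrm1 mulr1. Qed.

Lemma comm_rsc x r : GRing.comm x (rsc r).
Proof. by rewrite /GRing.comm rscC. Qed.

End NormBasics.

Ltac comm_split k :=
  lazymatch goal with
  | |- GRing.comm _ (_ + _) => apply: commrD; comm_split k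
  | |- GRing.comm _ (- _) => apply: commrN; comm_split k
  | |- GRing.comm _ (_ * _) => apply: commrM; comm_split k
  | |- GRing.comm _ 1 => exact: commr1
  | |- GRing.comm _ 0 => exact: commr0
  | |- GRing.comm _ (rsc _ _) => exact: comm_rsc
  | _ => k tt
  end.
Ltac comm_leaf _ :=
  rewrite /GRing.comm; first [reflexivity | assumption | symmetry; assumption].
(** Both sides are split into atoms; commutation of two atoms is taken from the hypotheses, in
    either orientation. *)
Ltac comm_ring :=
  lazymatch goal with
  | |- ?x * ?y = _ => change (GRing.comm x y)
  end;
  comm_split ltac:(fun _ => apply: commr_sym; comm_split comm_leaf).

Section Limits.
Variables (R : realType) (A : cstarAlgType R).
Implicit Types (x y z a b l : A) (r s t e : R) (u v : nat -> A).

Lemma nrm_subD x y z : nrm (x - z) <= nrm (x - y) + nrm (y - z).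
Proof. have -> : x - z = (x - y) + (y - z) by nc_ring. exact: nrmD. Qed.

Definition ncvg u l :=
  forall e, 0 < e -> exists N, forall n, (N <= n)%N -> nrm (u n - l) <= e.

Lemma ncvg_cst l : ncvg (fun=> l) l.
Proof. by move=> e e0; exists 0%N => n _; rewrite subrr nrm0 ltW. Qed.

Lemma ncvgD u v l k : ncvg u l -> ncvg v k -> ncvg (fun n => u n + v n) (l + k).
Proof.
move=> hu hv e e0; have e2 : 0 < e / 2 by rewrite divr_gt0.
have [N hN] := hu _ e2; have [M hM] := hv _ e2.
exists (maxn N M) => n; rewrite geq_max => /andP[/hN h1 /hM h2].
have -> : u n + v n - (l + k) = (u n - l) + (v n - k) by nc_ring.
by rewrite (le_trans (nrmD _ _)) // [e in _ <= e]splitr lerD.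
Qed.

Lemma ncvgN u l : ncvg u l -> ncvg (fun n => - u n) (- l).
Proof.
move=> hu e /hu[N hN]; exists N => n /hN h.
by rewrite -opprD nrmN.
Qed.

Lemma ncvgB u v l k : ncvg u l -> ncvg v k -> ncvg (fun n => u n - v n) (l - k).
Proof. by move=> hu /ncvgN; exact: ncvgD. Qed.

Lemma ncvgMl a u l : ncvg u l -> ncvg (fun n => a * u n) (a * l).
Proof.
move=> hu e e0; have a1 : 0 < nrm a + 1 by rewrite ltr_wpDl ?nrm_ge0.
have [N hN] := hu _ (divr_gt0 e0 a1).
exists N => n /hN h; rewrite -mulrBr (le_trans (nrmM _ _)) //.
rewrite (le_trans (ler_wpM2l (nrm_ge0 a) h)) // mulrCA ger_pMr //.
by rewrite ler_pdivrMr // mul1r lerDl ler01.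
Qed.

Lemma ncvg_star u l : ncvg u l -> ncvg (fun n => star (u n)) (star l).
Proof.
by move=> hu e /hu[N hN]; exists N => n /hN; rewrite -starB nrm_star.
Qed.

Lemma ncvgMr a u l : ncvg u l -> ncvg (fun n => u n * a) (l * a).
Proof.
move=> /ncvg_star/(ncvgMl (star a))/ncvg_star h e /h[N hN].
by exists N => n /hN; rewrite !starMr !starK.
Qed.

Lemma ncvg_bounded u l : ncvg u l -> exists N M, forall n, (N <= n)%N -> nrm (u n) <= M.
Proof.
move=> /(_ _ ltr01)[N hN]; exists N, (1 + nrm l) => n /hN h.
have -> : u n = (u n - l) + l by nc_ring.
by rewrite (le_trans (nrmD _ _)) // lerD2r.
Qed.

Lemma ncvgM u v l k : ncvg u l -> ncvg v k -> ncvg (fun n => u n * v n) (l * k).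
Proof.
move=> hu hv e e0; have [N [M hM]] := ncvg_bounded hv.
have M1 : 0 < `|M| + 1 by rewrite ltr_wpDl.
have e2 : 0 < e / 2 by rewrite divr_gt0.
have [N1 hN1] := hu _ (divr_gt0 e2 M1).
have [N2 hN2] := ncvgMl l hv e2.
exists (maxn N (maxn N1 N2)) => n; rewrite !geq_max => /and3P[/hM h /hN1 h1 /hN2 h2].
have -> : u n * v n - l * k = (u n - l) * v n + (l * v n - l * k) by nc_ring.
rewrite (le_trans (nrmD _ _)) // [e in _ <= e]splitr lerD //.
rewrite (le_trans (nrmM _ _)) // -[e / 2](divfK (lt0r_neq0 M1)).
apply: ler_pM; rewrite ?nrm_ge0 //.
by rewrite (le_trans h) // (le_trans (ler_norm _)) // lerDl.
Qed.

Lemma ncvg_nrm_le u l e : ncvg u l -> (exists N, forall n, (N <= n)%N -> nrm (u n) <= e) ->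
  nrm l <= e.
Proof.
move=> hu [M hM]; apply/ler_addgt0Pr => d /hu[N hN].
have h1 := hN _ (leq_maxl N M); have h2 := hM _ (leq_maxr N M).
have -> : l = u (maxn N M) - (u (maxn N M) - l) by nc_ring.
by rewrite (le_trans (nrmD _ _)) // nrmN lerD.
Qed.

Lemma ncvg_uniq u l k : ncvg u l -> ncvg u k -> l = k.
Proof.
move=> hl hk; apply/eqP; rewrite -subr_eq0; apply/eqP; apply: nrm_eq0.
apply: (@ncvg_nrm_le _ _ _ (ncvgB hl hk)) => //.
by exists 0%N => n _; rewrite subrr nrm0.
Qed.

Lemma ncvg_eq u v l : (forall n, u n = v n) -> ncvg u l -> ncvg v l.
Proof. by move=> e hu d /hu[N hN]; exists N => n /hN; rewrite e. Qed.

Lemma ncvg_shift u l : ncvg u l -> ncvg (fun n => u n.+1) l.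
Proof. by move=> hu d /hu[N hN]; exists N => n h; apply: hN; rewrite ltnW. Qed.

Lemma metric_closed (S : set A) :
  (forall z, (forall e, 0 < e -> exists2 s, S s & nrm (z - s) <= e) -> S z) -> closed S.
Proof.
move=> h z cz; apply: h => e e0.
have eC : 0 < e%:C by rewrite ltcR.
have [s [Ss]] := cz _ (@nbhsx_ballx _ _ z _ eC).
rewrite -ball_normE /= => hs; exists s => //.
by rewrite -lecR -nrmE ltW.
Qed.

Lemma cauchy_ncvg u : (forall e, 0 < e -> exists N, forall n m, (N <= n)%N -> (n <= m)%N ->
    nrm (u m - u n) <= e) -> exists l, ncvg u l.
Proof.
move=> hu.
have /cauchy_cvgP cu : cauchy (u @ \oo).
  apply/cauchy_ballP => e e0.
  have [r r0 er] : exists2 r : R, 0 < r & r%:C = e.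
    exists (complex.Re e); first by rewrite -ltcR RRe_real ?gtr0_real.
    by rewrite RRe_real ?gtr0_real.
  have [N hN] := hu (r / 3) (divr_gt0 r0 (ltr0n R 3)).
  have r3 : 0 < r / 3 by rewrite divr_gt0.
  suff H n m : (N <= n)%N -> (N <= m)%N -> ball (u n) e (u m).
    exists ([set u n | n in [set n | (N <= n)%N]], [set u n | n in [set n | (N <= n)%N]]) => /=.
      by split; exists N => // n /= hn; exists n.
    by move=> [? ?] [/= [n hn <-] [m hm <-]]; exact: H.
  move=> hn hm; rewrite -ball_normE /= nrmE -er ltcR.
  apply: (le_lt_trans (nrm_subD _ (u N) _)).
  apply: (@le_lt_trans _ _ (r / 3 + r / 3)); last by lra.
  by apply: lerD; [exact: hN|rewrite nrm_subC; exact: hN].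
exists (lim (u @ \oo)) => e e0.
have eC : 0 < e%:C by rewrite ltcR.
have [N _ hN] := cu _ (@nbhsx_ballx _ _ (lim (u @ \oo)) _ eC).
exists N => n /hN; rewrite -ball_normE /= nrmE ltcR nrm_subC => /ltW //.
Qed.

(** The sequence [t] is nondecreasing, and if [u] were not Cauchy, [t] would grow by more than some
    fixed [e] again and again, against its bound. *)
Lemma dominated_ncvg u (t : nat -> R) M :
  (forall n, nrm (u n.+1 - u n) <= t n.+1 - t n) -> (forall n, t n <= M) ->
  exists l, ncvg u l.
Proof.
move=> hu ht.
have hum n m : (n <= m)%N -> nrm (u m - u n) <= t m - t n.
  move=> /subnK <-; elim: (m - n)%N => [|k IH]; first by rewrite add0n !subrr nrm0.
  rewrite addSn (le_trans (nrm_subD _ (u (k + n)%N) _)) //.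
  rewrite (le_trans (lerD (hu _) IH)) //; lra.
apply: cauchy_ncvg => e e0; apply: contrapT => /forallNP hN.
have {hN} hN n : exists m, t n + e < t m.
  have /existsNP[k /existsNP[m /not_implyP[nk /not_implyP[km]]]] := hN n.
  move/negP; rewrite -ltNge => lt; exists m.
  have h1 := hum _ _ km; have := hum _ _ nk; have := nrm_ge0 (u k - u n); lra.
have H k : exists m, t 0 + e *+ k <= t m.
  elim: k => [|k [m hm]]; first by exists 0%N; rewrite mulr0n addr0.
  have [m' hm'] := hN m; exists m'; rewrite mulrS; lra.
have [m hm] := H (Num.bound ((M - t 0) / e)).
have : (M - t 0) / e < (Num.bound ((M - t 0) / e))%:R.
  by rewrite archi_boundP // divr_ge0 ?subr_ge0 // ltW.
rewrite ltr_pdivrMr // mulr_natl => h; have := ht m; lra.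
Qed.

(** The inverse is the limit of [u <- 1 + x u], the partial sums of the geometric series, dominated
    by the scalar series at [nrm x]. *)
Lemma neumann x : nrm x < 1 -> exists i, [/\ i * (1 - x) = 1, (1 - x) * i = 1
  & forall z, z * x = x * z -> z * i = i * z].
Proof.
move=> x1.
pose u := fix u n := if n is m.+1 then 1 + x * u m else 0.
pose t := fix t n : R := if n is m.+1 then 1 + nrm x * t m else 0.
have [||l hl] := @dominated_ncvg u t (1 - nrm x)^-1.
- elim=> [|n IH] /=; first by rewrite !mulr0 !addr0 !subr0 nrm1.
  have -> : 1 + x * (1 + x * u n) - (1 + x * u n) = x * (1 + x * u n - u n) by nc_ring.
  apply: (le_trans (nrmM _ _)).
  have := ler_wpM2l (nrm_ge0 x) IH; rewrite /=; lra.
- have x1' : 0 < 1 - nrm x by rewrite subr_gt0.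
  elim=> [|n IH] /=; first by rewrite invr_ge0 ltW.
  have := ler_wpM2l (nrm_ge0 x) IH => h.
  rewrite (le_trans (lerD (lexx 1) h)) //.
  rewrite -(ler_pM2l x1') divff ?lt0r_neq0 // mulrDr mulr1 mulrCA divff ?lt0r_neq0 //.
  lra.
have lE : l = 1 + x * l.
  apply: (ncvg_uniq (ncvg_shift hl)) => /=.
  exact: ncvgD (ncvg_cst _) (ncvgMl _ hl).
have cl z : z * x = x * z -> z * l = l * z.
  move=> zx; apply: (ncvg_uniq (ncvgMl z hl)); apply: ncvg_eq (ncvgMr z hl) => n.
  elim: n => [|n IH] /=; first by rewrite mulr0 mul0r.
  by rewrite mulrDl mulrDr mul1r mulr1 !mulrA zx -!mulrA IH.
have l1 : (1 - x) * l = 1 by rewrite mulrBl mul1r {1}lE addrK.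
exists l; split=> //.
rewrite -[RHS]l1 mulrBr mulrBl mulr1 mul1r cl //.
Qed.

(* [1 - y] is the square root of [1 - x]; the iteration
   [y <- (x + y^2) / 2] is dominated by its scalar version with [x = 1], which
   still converges at the boundary [|x| = 1]. *)
Lemma sqrt_iter x : nrm x <= 1 -> exists y,
  [/\ y + y = x + y * y, nrm y <= 1,
      forall z, z * x = x * z -> z * y = y * z
    & star x = x -> star y = y].
Proof.
move=> x1; pose h : R := 2^-1.
have h0 : 0 <= h by rewrite /h invr_ge0.
pose u := fix u n := if n is m.+1 then rsc A h * (x + u m * u m) else 0.
pose t := fix t n : R := if n is m.+1 then h * (1 + t m * t m) else 0.
have t01 n : 0 <= t n <= 1.
  elim: n => [|n IH] /=; first by rewrite lexx ler01.
  by rewrite /h; case/andP: IH => ? ?; apply/andP; split; nra.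
have ut n : nrm (u n) <= t n.
  elim: n => [|n IH] /=; first by rewrite nrm0.
  rewrite (le_trans (nrmM _ _)) // nrm_rsc ger0_norm // ler_wpM2l //.
  rewrite (le_trans (nrmD _ _)) // lerD // (le_trans (nrmM _ _)) //.
  by rewrite ler_pM ?nrm_ge0.
have uC z : z * x = x * z -> forall n, z * u n = u n * z.
  move=> zx; elim=> [|n IH] /=; first by rewrite mulr0 mul0r.
  rewrite mulrA -rscC -!mulrA; congr (_ * _).
  by rewrite mulrDl mulrDr zx mulrA IH -!mulrA IH.
have [||l hl] := @dominated_ncvg u t 1.
- elim=> [|n IH] /=.
    rewrite !mulr0 !addr0 !subr0 mulr1 (le_trans (nrmM _ _)) // nrm_rsc ger0_norm //.
    by rewrite ger_pMr // /h invr_gt0.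
  set v := rsc A h * (x + u n * u n); set s := h * (1 + t n * t n).
  have vv : v * u n = u n * v.
    exact: uC _ (esym (uC x erefl n.+1)) n.
  have -> : rsc A h * (x + v * v) - v = rsc A h * ((v - u n) * (v + u n)).
    have -> : (v - u n) * (v + u n) = v * v - u n * u n.
      by rewrite mulrBl !mulrDr vv; nc_ring.
    by rewrite {3}/v; nc_ring.
  rewrite (le_trans (nrmM _ _)) // nrm_rsc ger0_norm //.
  have -> : h * (1 + s * s) - s = h * ((s - t n) * (s + t n)).
    by rewrite {3}/s; ring.
  rewrite ler_wpM2l // (le_trans (nrmM _ _)) // ler_pM ?nrm_ge0 //.
  by rewrite (le_trans (nrmD _ _)) // lerD // (ut n.+1).
- by move=> n; case/andP: (t01 n).
have hh : rsc A h + rsc A h = 1 by rewrite -rscD -rsc1; congr (rsc _ _); rewrite /h; lra.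
have lE : l = rsc A h * (x + l * l).
  apply: (ncvg_uniq (ncvg_shift hl)) => /=.
  exact: ncvgMl (ncvgD (ncvg_cst _) (ncvgM hl hl)).
exists l; split.
- by rewrite {1 2}lE -mulrDl hh mul1r.
- apply: (ncvg_nrm_le hl); exists 0%N => n _.
  by rewrite (le_trans (ut n)) //; case/andP: (t01 n).
- move=> z zx; apply: (ncvg_uniq (ncvgMl z hl)); apply: ncvg_eq (ncvgMr z hl) => n.
  by rewrite (uC z zx).
- move=> sx; apply: (ncvg_uniq (ncvg_star hl)); apply: ncvg_eq hl => n.
  elim: n => [|n IH] /=; first by rewrite star0.
  by rewrite starMr star_rsc starD starMr -IH sx rscC.
Qed.

End Limits.

(** * The positive cone *)

Section Positivity.
Variables (R : realType) (A : cstarAlgType R).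
Implicit Types (x y z a b c d : A) (r s t e : R).
Local Notation rsc := (rsc A).

(* For self-adjoint [a], [|t - a| <= t] says that the spectrum of [a] lies in
   [0, 2 t]; unlike [a = b^* b], this condition is visibly stable under sums
   and limits. *)
Definition Pos a := star a = a /\ exists t, nrm (rsc t - a) <= t.
(** Membership of [c] in the bicommutant of [a]. It stands in for [c] being a function of [a]:
    square roots, moduli and positive parts carry it, and it supplies the commutations that
    functional calculus would give. *)
Definition comm2 a c := forall z, z * a = a * z -> z * c = c * z.

Lemma comm2_trans a b c : comm2 a b -> comm2 b c -> comm2 a c.
Proof. by move=> ab bc z /ab/bc. Qed.

Lemma comm2_comm a c : comm2 a c -> a * c = c * a.
Proof. exact. Qed.

Lemma Pos_sa a : Pos a -> star a = a. Proof. by case. Qed.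

Lemma sa_eq0 x : star x = x -> x * x = 0 -> x = 0.
Proof.
move=> sx xx; apply: nrm_eq0; have := nrm_sa sx; rewrite xx nrm0 => /esym/eqP.
by rewrite sqrf_eq0 => /eqP ->.
Qed.

Lemma star_mul_eq0 x : star x * x = 0 -> x = 0.
Proof.
move=> xx; apply: nrm_eq0; have := nrm_starM x; rewrite xx nrm0 => /esym/eqP.
by rewrite sqrf_eq0 => /eqP ->.
Qed.

Lemma Pos_rsc r : 0 <= r -> Pos (rsc r).
Proof.
by move=> r0; split; [exact: star_rsc|exists r; rewrite subrr nrm0].
Qed.

Lemma Pos0 : Pos 0. Proof. by rewrite -(rsc0 A); apply: Pos_rsc. Qed.
Lemma Pos1 : Pos 1. Proof. by rewrite -(rsc1 A); apply: Pos_rsc. Qed.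

Lemma PosD a b : Pos a -> Pos b -> Pos (a + b).
Proof.
move=> [sa [t ht]] [sb [s hs]]; split; first by rewrite starD sa sb.
exists (t + s); rewrite rscD.
have -> : rsc t + rsc s - (a + b) = (rsc t - a) + (rsc s - b) by nc_ring.
by rewrite (le_trans (nrmD _ _)) // lerD.
Qed.

Lemma Pos_sum (I : Type) (l : seq I) (P : pred I) (F : I -> A) :
  (forall i, P i -> Pos (F i)) -> Pos (\sum_(i <- l | P i) F i).
Proof. by move=> h; apply: big_ind => //; [exact: Pos0|exact: PosD]. Qed.

Lemma PosZ r a : 0 <= r -> Pos a -> Pos (rsc r * a).
Proof.
move=> r0 [sa [t ht]]; split; first by rewrite starMr star_rsc sa rscC.
exists (r * t); rewrite rscM -mulrBr (le_trans (nrmM _ _)) // nrm_rsc.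
by rewrite ger0_norm // ler_wpM2l.
Qed.

(** Division by [t] turns the condition into [nrm (1 - a / t) <= 1]. If [1 - y] is the root of
    [a / t] given by [sqrt_iter], then [sqrt t (1 - y)] is a root of [a], positive because
    [nrm y <= 1]. *)
Lemma Pos_sqrt a : Pos a ->
  exists c, [/\ star c = c, c * c = a, comm2 a c & Pos c].
Proof.
move=> [sa [t ht]]; have t0 : 0 <= t := le_trans (nrm_ge0 _) ht.
(* The division requires [t > 0]; for [t = 0] the bound forces [a = 0]. *)
move: t0; rewrite le_eqVlt => /predU1P[t0|t0].
  have a0 : a = 0.
    by apply: nrm_eq0; move: ht; rewrite -t0 rsc0 sub0r nrmN.
  exists 0; split; rewrite ?star0 ?mul0r ?a0 //; last exact: Pos0.
have tt : rsc t * rsc t^-1 = 1 by rewrite -rscM divff ?rsc1 // lt0r_neq0.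
have [|y [yy y1 yC ysa]] := @sqrt_iter _ _ (1 - rsc t^-1 * a).
  have -> : 1 - rsc t^-1 * a = rsc t^-1 * (rsc t - a).
    by rewrite mulrBr -[X in X - _]tt rscC.
  rewrite (le_trans (nrmM _ _)) // nrm_rsc ger0_norm ?invr_ge0 ?(ltW t0) //.
  by rewrite ler_pdivrMl // mulr1.
have sy : star y = y.
  by apply: ysa; rewrite starB star1 starMr star_rsc sa rscC.
have cy : forall z, z * a = a * z -> z * y = y * z.
  move=> z za; apply: yC.
  rewrite mulrBr mulrBl mulr1 mul1r mulrA -rscC -!mulrA za //.
pose w := Num.sqrt t; have w0 : 0 <= w by exact: sqrtr_ge0.
have ww : rsc w * rsc w = rsc t.
  by rewrite -rscM -expr2 sqr_sqrtr // ltW.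
have scc : star (rsc w * (1 - y)) = rsc w * (1 - y).
  by rewrite starMr star_rsc starB star1 sy rscC.
exists (rsc w * (1 - y)); split => //.
- have -> : rsc w * (1 - y) * (rsc w * (1 - y)) = rsc w * rsc w * ((1 - y) * (1 - y)).
    by rewrite -!mulrA; congr (_ * _); rewrite !mulrA -rscC.
  have -> : (1 - y) * (1 - y) = 1 - (y + y) + y * y by nc_ring.
  rewrite yy ww.
  have -> : 1 - (1 - rsc t^-1 * a + y * y) + y * y = rsc t^-1 * a by nc_ring.
  by rewrite mulrA tt mul1r.
- move=> z /cy zy; rewrite mulrA -rscC -!mulrA; congr (_ * _).
  by rewrite mulrBr mulrBl zy mulr1 mul1r.
- split => //; exists w; have -> : rsc w - rsc w * (1 - y) = rsc w * y by nc_ring.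
  by rewrite (le_trans (nrmM _ _)) // nrm_rsc ger0_norm // ger_pMr // sqrtr_gt0.
Qed.

Definition psqrt a : A :=
  if pselect (Pos a) is left h then projT1 (cid (Pos_sqrt h)) else 0.

Lemma psqrtP a : Pos a ->
  [/\ star (psqrt a) = psqrt a, psqrt a * psqrt a = a, comm2 a (psqrt a) &
      Pos (psqrt a)].
Proof.
by rewrite /psqrt; case: pselect => // h _; exact: projT2 (cid (Pos_sqrt h)).
Qed.

Lemma half_sum x : rsc 2^-1 * (x + x) = x.
Proof.
have h : rsc 2^-1 + rsc 2^-1 = 1.
  by rewrite -rscD -(rsc1 A); have -> : (2^-1 + 2^-1 : R) = 1 by lra.
have -> : rsc 2^-1 * (x + x) = (rsc 2^-1 + rsc 2^-1) * x by nc_ring.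
by rewrite h mul1r.
Qed.

(* [c + i d] is normal with [|c + i d|^2 = c^2 + d^2]. *)
Lemma unit_circle c d t : star c = c -> star d = d -> c * d = d * c ->
  c * c + d * d = rsc t -> nrm c ^+ 2 <= `|t|.
Proof.
move=> sc sd cd e; pose j : A := 'i%C *: 1.
have jC x : x * j = j * x by rewrite /j -scalerAl -scalerAr mul1r mulr1.
have jj : j * j = - 1.
  by rewrite /j -scalerAl mul1r scalerA -expr2 sqr_i scaleN1r.
have sj : star j = - j.
  by rewrite /j starZ star1 -scaleNr; congr (_ *: _); simpc.
have sw : star (c + j * d) = c - j * d.
  by rewrite starD starMr sc sd sj mulrN jC.
have hw : nrm (c + j * d) ^+ 2 = `|t|.
  rewrite -nrm_starM sw.
  have -> : (c - j * d) * (c + j * d) = c * c + (c * j) * d - j * (d * c) - j * (d * j) * d.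
    by nc_ring.
  rewrite !jC -cd !mulrA jj -(nrm_rsc A) -e; congr (nrm _); nc_ring.
rewrite -hw lerXn2r ?nnegrE ?nrm_ge0 //.
have {1}-> : c = rsc 2^-1 * ((c + j * d) + star (c + j * d)).
  rewrite sw -[LHS]half_sum; congr (_ * _); nc_ring.
rewrite (le_trans (nrmM _ _)) // nrm_rsc ger0_norm ?invr_ge0 //.
rewrite mulrC ler_pdivrMr // (le_trans (nrmD _ _)) // nrm_star; lra.
Qed.

Lemma Pos_sub_nrm a t : star a = a -> nrm a <= t -> Pos (rsc t - a).
Proof.
move=> sa at_; split; first by rewrite starB star_rsc sa.
exists t; have -> : rsc t - (rsc t - a) = a by nc_ring.
by [].
Qed.

(** With [K = nrm b ^ 2] and [s] a root of [K - b^2], one has [s^2 + b^2 = K], so [unit_circle]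
    yields [nrm (K - b^2) = nrm s ^ 2 <= K]. *)
Lemma Pos_sq b : star b = b -> Pos (b * b).
Proof.
move=> sb; have sbb : star (b * b) = b * b by rewrite starMr sb.
split=> //; pose K := nrm b ^+ 2; exists K.
have K0 : 0 <= K by exact: sqr_ge0.
have h : nrm (b * b) <= K by rewrite /K nrm_sa.
have [s [ss sE sC _]] := Pos_sqrt (Pos_sub_nrm sbb h).
rewrite -sE nrm_sa // -[X in _ <= X](ger0_norm K0).
apply: (@unit_circle s b) => //; last by rewrite sE; nc_ring.
by apply/esym/sC; rewrite mulrBr mulrBl rscC mulrA.
Qed.

Lemma PosM a b : a * b = b * a -> Pos a -> Pos b -> Pos (a * b).
Proof.
move=> ab /Pos_sqrt[c [sc cc cC _]] /Pos_sqrt[d [sd dd dC _]].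
have cb : c * b = b * c by apply/esym/cC.
have cd : c * d = d * c by exact: dC.
have -> : a * b = (c * d) * (c * d).
  by rewrite -{1}cc -dd -!mulrA; congr (_ * _); rewrite !mulrA cd.
by apply: Pos_sq; rewrite starMr sc sd cd.
Qed.

Lemma Pos_rsc_ge0 t : Pos (rsc t) -> 0 <= t.
Proof.
move=> [_ [s]]; rewrite -rscN -rscD nrm_rsc => h.
have := ler_norm (s - t); have := ler_norm (- (s - t)); rewrite normrN; lra.
Qed.

(** The roots of [a] and of [t - a] commute and their squares add up to [t], so [unit_circle]
    applies again. *)
Lemma Pos_nrm_le a t : Pos a -> Pos (rsc t - a) -> nrm a <= t.
Proof.
move=> pa pb; have t0 : 0 <= t.
  by apply: Pos_rsc_ge0; have := PosD pa pb; rewrite addrC subrK.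
have [c [sc cc cC _]] := Pos_sqrt pa; have [d [sd dd dC _]] := Pos_sqrt pb.
have da : d * a = a * d.
  have -> : a = rsc t - d * d by rewrite dd; nc_ring.
  by rewrite mulrBr mulrBl rscC mulrA.
rewrite -{1}cc nrm_sa // -[X in _ <= X](ger0_norm t0).
apply: (@unit_circle c d) => //; first by apply/esym/cC.
by rewrite cc dd; nc_ring.
Qed.

Lemma nrm_rsc_sub a t : Pos a -> nrm a <= t -> nrm (rsc t - a) <= t.
Proof.
move=> pa h; apply: Pos_nrm_le; first exact: Pos_sub_nrm (Pos_sa pa) h.
by have -> : rsc t - (rsc t - a) = a by nc_ring.
Qed.

Lemma Pos_le_nrm a b : Pos a -> Pos (b - a) -> nrm a <= nrm b.
Proof.
move=> pa pab; apply: Pos_nrm_le => //.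
have sb : star b = b by rewrite -(subrK a b) starD !Pos_sa.
have -> : rsc (nrm b) - a = (rsc (nrm b) - b) + (b - a) by nc_ring.
by apply: PosD => //; apply: Pos_sub_nrm.
Qed.

Lemma Pos_anti a : Pos a -> Pos (- a) -> a = 0.
Proof.
by move=> pa na; apply: nrm_eq0; apply: Pos_nrm_le => //; rewrite rsc0 sub0r.
Qed.

Lemma Pos_add_eq0 a b : Pos a -> Pos b -> a + b = 0 -> a = 0.
Proof.
move=> pa pb ab; apply: Pos_anti => //.
by have -> : - a = b by apply/eqP; rewrite eq_sym -addr_eq0 addrC ab.
Qed.

(** The parameter [nrm a + 1] serves all approximants within distance 1 of [a] at once, so the norm
    condition passes to the limit. *)
Lemma Pos_closed a :
  (forall e, 0 < e -> exists2 b, Pos b & nrm (a - b) <= e) -> Pos a.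
Proof.
move=> h.
have sa : star a = a.
  apply/eqP; rewrite -subr_eq0; apply/eqP; apply: nrm_eq0.
  apply/ler_addgt0Pr => e e0; rewrite add0r.
  have [b pb hb] := h (e / 2) (divr_gt0 e0 (ltr0Sn R 1)).
  have -> : star a - a = star (a - b) - (a - b) by rewrite starB (Pos_sa pb); nc_ring.
  by rewrite (le_trans (nrmD _ _)) // nrmN nrm_star [leRHS]splitr lerD.
split=> //; exists (nrm a + 1); apply/ler_addgt0Pr => e e0.
have [b pb hb] : exists2 b, Pos b & nrm (a - b) <= Num.min e 1.
  by apply: h; rewrite lt_min e0 ltr01.
move: hb; rewrite le_min => /andP[be b1].
have bK : nrm b <= nrm a + 1.
  have -> : b = a - (a - b) by nc_ring.
  by rewrite (le_trans (nrmD _ _)) // nrmN lerD.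
rewrite (le_trans (nrm_subD _ b _)) //.
by apply: lerD; [exact: nrm_rsc_sub|rewrite nrm_subC].
Qed.

(** For [d = a - b], the elements [d^2 a] and [d^2 b] are positive with sum [d (a^2 - b^2) = 0].
    Both vanish, hence [d^3 = 0], and [d = 0] by self-adjointness. *)
Lemma Pos_sq_uniq a b : a * b = b * a -> Pos a -> Pos b -> a * a = b * b -> a = b.
Proof.
move=> ab pa pb aabb; set d := a - b.
have sd : star d = d by rewrite starB !Pos_sa.
have da : a * d = d * a by rewrite /d mulrBr mulrBl ab.
have db : b * d = d * b by rewrite /d mulrBr mulrBl ab.
have pda : Pos (d * d * a) by apply: PosM => //; [rewrite mulrA da -!mulrA da|exact: Pos_sq].
have pdb : Pos (d * d * b) by apply: PosM => //; [rewrite mulrA db -!mulrA db|exact: Pos_sq].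
have d0 : d * (a + b) = 0.
  have -> : d * (a + b) = a * a - b * b + (a * b - b * a) by rewrite /d; nc_ring.
  by rewrite aabb ab !subrr addr0.
have e : d * d * a + d * d * b = 0 by rewrite -mulrDr -mulrA d0 mulr0.
have ea := Pos_add_eq0 pda pdb e.
have eb : d * d * b = 0 by move: e; rewrite ea add0r.
have ddd : d * d * d = 0 by rewrite {3}/d mulrBr ea eb subrr.
have dd : d * d = 0.
  by apply: sa_eq0; [rewrite starMr sd|rewrite mulrA ddd mul0r].
by apply/eqP; rewrite -subr_eq0; apply/eqP; apply: sa_eq0.
Qed.

Definition absv b := psqrt (b * b).

(* The positive square root [n] of [q^2], for [q = m + b], satisfies
   [n^2 = 2 m n] by uniqueness of square roots, which forces [q = n]. *)
Lemma absvP b : star b = b -> [/\ absv b * absv b = b * b, comm2 b (absv b),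
  Pos (absv b + b) & Pos (absv b - b)].
Proof.
have main b0 m : star b0 = b0 -> Pos m -> m * m = b0 * b0 -> comm2 b0 m -> Pos (m + b0).
  move=> sb pm mm mC; set q := m + b0.
  have bm : b0 * m = m * b0 by exact: mC.
  have sq : star q = q by rewrite starD sb Pos_sa.
  have mq : m * q = q * m by rewrite mulrDr mulrDl bm.
  have bq : b0 * q = q * b0 by rewrite mulrDr mulrDl bm.
  have [n [sn nn nC pn]] := Pos_sqrt (Pos_sq sq).
  have mn : m * n = n * m by apply: nC; rewrite mulrA mq -!mulrA mq.
  have bn : b0 * n = n * b0 by apply: nC; rewrite mulrA bq -!mulrA bq.
  have qn : q * n = n * q by apply: nC; rewrite mulrA.
  have qq : q * q = m * q + m * q.
    have -> : q * q = m * q + (b0 * b0 + b0 * m) by rewrite /q; nc_ring.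
    by rewrite -mm bm -mulrDr.
  (* Both sides are positive with the same square: [(2 m n)^2 = (2 m q)^2 = (q^2)^2 = (n^2)^2]. *)
  have nmn : n * n = m * n + m * n.
    apply: Pos_sq_uniq; last 1 first.
    - have e : (m * n + m * n) * (m * n + m * n) = (m * q + m * q) * (m * q + m * q).
        have h w : m * w = w * m -> (m * w + m * w) * (m * w + m * w) =
            (m * m * (w * w) + m * m * (w * w)) + (m * m * (w * w) + m * m * (w * w)).
          move=> mw; have -> : (m * w + m * w) * (m * w + m * w) =
            ((m * (w * m) * w) + (m * (w * m) * w)) + ((m * (w * m) * w) + (m * (w * m) * w)).
            by nc_ring.
          by rewrite -mw; nc_ring.
        by rewrite (h _ mn) (h _ mq) nn.
      by rewrite e -qq nn.
    - comm_ring.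
    - exact: Pos_sq.
    - by apply: PosD; exact: PosM.
  (* The difference [k] is killed by [m], hence by [b0] as [b0^2 = m^2], hence by [q]. Since also
     [(n + q) k = n^2 - q^2 = 0], it follows that [k^2 = 0]. *)
  set k := n - q; have sk : star k = k by rewrite starB sn sq.
  have kn : k * n = n * k by rewrite mulrBr mulrBl qn.
  have bk : b0 * k = k * b0 by rewrite mulrBr mulrBl bn bq.
  have mk : m * k = 0.
    rewrite -[LHS]half_sum /k mulrBr.
    have -> : m * n - m * q + (m * n - m * q) = (m * n + m * n) - (m * q + m * q) by nc_ring.
    by rewrite -nmn -qq nn subrr mulr0.
  have bk0 : b0 * k = 0.
    apply: sa_eq0; first by rewrite starMr sk sb bk.
    by rewrite {1}bk mulrA -[k * b0 * b0]mulrA -mm -!mulrA mk !mulr0.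
  have qk : q * k = 0 by rewrite mulrDl mk bk0 addr0.
  have kk : k * k = 0.
    have e0 : (n + q) * k = 0.
      rewrite /k mulrDl !mulrBr -nn qn; nc_ring.
    have nk : n * k = 0 by move: e0; rewrite mulrDl qk addr0.
    by rewrite {1}/k mulrBl nk qk subrr.
  have -> // : q = n.
  by apply/esym/eqP; rewrite -subr_eq0; apply/eqP; exact: sa_eq0.
move=> sb; have := psqrtP (Pos_sq sb); rewrite -/(absv b); set m := absv b => -[sm mm mC pm].
have mC' : comm2 b m by move=> z zb; apply: mC; rewrite mulrA zb -!mulrA zb.
split=> //; first exact: main.
apply: main; rewrite ?starN ?sb ?mulrNN //.
by move=> z; rewrite mulrN mulNr => /oppr_inj; exact: mC'.
Qed.

(** The negative part of [b] gets no name of its own: it is written [ppart b - b], which [ppartN]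
    identifies with [ppart (- b)]. *)
Definition ppart b := rsc 2^-1 * (absv b + b).

Lemma ppartN b : ppart (- b) = ppart b - b.
Proof.
have -> : ppart (- b) = rsc 2^-1 * (absv b - b) by rewrite /ppart /absv mulrNN.
rewrite -[X in _ = _ - X]half_sum -mulrBr; congr (_ * _); nc_ring.
Qed.

Lemma ppartP b : star b = b -> [/\ Pos (ppart b), Pos (ppart b - b),
  ppart b * (ppart b - b) = 0 & comm2 b (ppart b)].
Proof.
move=> sb; have [mm mC pp pq] := absvP sb.
have h0 : 0 <= (2^-1 : R) by rewrite invr_ge0.
have bm : b * absv b = absv b * b by exact: mC.
split.
- exact: PosZ.
- by rewrite -ppartN /ppart /absv mulrNN; apply: PosZ.
- rewrite -ppartN /ppart /absv mulrNN -/(absv b) -!mulrA [(_ + b) * (rsc _ * _)]mulrA.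
  rewrite -[(_ + b) * rsc _]rscC.
  have -> : rsc 2^-1 * (absv b + b) * (absv b - b) = rsc 2^-1 *
     (absv b * absv b - b * b + (b * absv b - absv b * b)) by nc_ring.
  by rewrite mm bm !subrr addr0 !mulr0.
- move=> z zb; have zm := mC _ zb; rewrite /ppart; comm_ring.
Qed.

(** With [K = nrm c + e], the element [(c + e) / K] differs from 1 by [(nrm c - c) / K], of norm
    less than 1. The inverse is positive since [i = i^2 (c + e)]. *)
Lemma pos_inv c e : Pos c -> 0 < e -> exists i,
  [/\ i * (c + rsc e) = 1, (c + rsc e) * i = 1, Pos i & comm2 c i].
Proof.
move=> pc e0; set K := nrm c + e.
have K0 : 0 < K by rewrite ltr_wpDl ?nrm_ge0.
have KK : rsc K * rsc K^-1 = 1 by rewrite -rscM divff ?rsc1 // lt0r_neq0.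
have xE : 1 - rsc K^-1 * (c + rsc e) = rsc K^-1 * (rsc (nrm c) - c).
  by rewrite -[X in X - _]KK rscC -mulrBr /K rscD; congr (_ * _); nc_ring.
have [|j [j1 j2 jC]] := @neumann _ _ (1 - rsc K^-1 * (c + rsc e)).
  rewrite xE (le_lt_trans (nrmM _ _)) // nrm_rsc ger0_norm ?invr_ge0 ?ltW //.
  rewrite mulrC ltr_pdivrMr // mul1r (le_lt_trans (nrm_rsc_sub pc (lexx _))) //.
  by rewrite ltrDl.
have E : 1 - (1 - rsc K^-1 * (c + rsc e)) = rsc K^-1 * (c + rsc e) by nc_ring.
rewrite E in j1 j2.
pose i := rsc K^-1 * j.
have i1 : i * (c + rsc e) = 1 by rewrite /i rscC -mulrA.
have i2 : (c + rsc e) * i = 1 by rewrite /i mulrA -rscC.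
have sce : star (c + rsc e) = c + rsc e by rewrite starD star_rsc Pos_sa.
have si : star i = i.
  have h : star i * (c + rsc e) = 1 by rewrite -{1}sce -starMr i2 star1.
  by rewrite -[LHS]mulr1 -i2 mulrA h mul1r.
have iC : comm2 c i.
  move=> z zc; have zj : z * j = j * z by apply: jC; comm_ring.
  rewrite /i; comm_ring.
exists i; split=> //.
have ci : c * i = i * c by exact: iC.
have -> : i = (i * i) * (c + rsc e) by rewrite -mulrA i1 mulr1.
apply: PosM; [|exact: Pos_sq|exact: PosD (Pos_rsc (ltW e0))].
by rewrite -mulrA i1 mulrA i2 mulr1 mul1r.
Qed.

Lemma cartesian x : exists h k, [/\ star h = h, star k = k, x = h + 'i%C *: k &
  star x * x + x * star x = (h * h + k * k) + (h * h + k * k)].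
Proof.
pose j : A := 'i%C *: 1.
have jC y : y * j = j * y by rewrite /j -scalerAl -scalerAr mul1r mulr1.
have jj : j * j = - 1.
  by rewrite /j -scalerAl mul1r scalerA -expr2 sqr_i scaleN1r.
have sj : star j = - j.
  by rewrite /j starZ star1 -scaleNr; congr (_ *: _); simpc.
pose h := rsc 2^-1 * (x + star x); pose k := - (j * (rsc 2^-1 * (x - star x))).
have sh : star h = h by rewrite /h starMr star_rsc starD starK rscC addrC.
have sk : star k = k.
  rewrite /k starN !starMr sj star_rsc starB starK mulrN opprK.
  rewrite jC -rscC; nc_ring.
have xE : x = h + j * k.
  rewrite /k mulrN [j * (j * _)]mulrA jj mulN1r opprK /h -mulrDr -[LHS]half_sum; congr (_ * _); nc_ring.
have sx : star x = h - j * k by rewrite {1}xE starD starMr sh sk sj mulrN jC.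
exists h, k; split=> //; first by rewrite {1}xE /j -scalerAl mul1r.
rewrite sx {1 2}xE.
have -> : (h - j * k) * (h + j * k) + (h + j * k) * (h - j * k) =
  (h * h - j * (k * j) * k) + (h * h - j * (k * j) * k) by nc_ring.
by rewrite jC !mulrA jj; nc_ring.
Qed.

End Positivity.

(** * Positivity of [x^* x], layers, polar decomposition *)

Section StarMul.
Variables (R : realType) (A : cstarAlgType R).
Implicit Types (x y z a b c d : A) (r s t e : R).
Local Notation rsc := (rsc A).

(* The usual proof compares the spectra of [y^* y] and [y y^*]; here the
   functions [t (1 - t / K)^m] play the role of the spectrum: they are bounded
   on [0, K] uniformly in [m], and unbounded at each [t < 0]. *)
Lemma star_mul_neg_eq0 y c : Pos c -> star y * y = - c -> c = 0.
Proof.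
move=> pc yy; pose d := y * star y.
(* By the Cartesian decomposition, [y y^* = 2 (h^2 + k^2) - y^* y], and [- y^* y] is [c]. *)
have pd : Pos d.
  have [h [k [sh sk _]]] := cartesian y.
  rewrite yy => e; have -> : d = (h * h + k * k) + (h * h + k * k) + c.
    by rewrite -e /d; nc_ring.
  by do !(apply: PosD => //); exact: Pos_sq.
pose K := nrm d + 1; have K0 : 0 < K by rewrite ltr_wpDl ?nrm_ge0.
have KK : rsc K^-1 * rsc K = 1 by rewrite -rscM mulVf ?rsc1 // lt0r_neq0.
pose f := 1 - rsc K^-1 * d; pose z := rsc K^-1 * c.
have fy : f * y = y * (1 + z).
  rewrite /f /z /d mulrBl mul1r mulrDr mulr1 -!mulrA yy [y * (rsc _ * c)]mulrA -[y * rsc _]rscC; nc_ring.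
have fmy m : f ^+ m * y = y * (1 + z) ^+ m.
  elim: m => [|m IH]; first by rewrite !expr0 mul1r mulr1.
  by rewrite exprS -mulrA IH mulrA fy -mulrA -exprS.
have f1 : nrm f <= 1.
  have -> : f = rsc K^-1 * (rsc K - d) by rewrite mulrBr KK.
  rewrite (le_trans (nrmM _ _)) // nrm_rsc ger0_norm ?invr_ge0 ?(ltW K0) //.
  by rewrite ler_pdivrMl // mulr1; apply: nrm_rsc_sub => //; rewrite lerDl.
have fm1 m : nrm (f ^+ m) <= 1.
  elim: m => [|m IH]; first by rewrite expr0 nrm1.
  by rewrite exprS (le_trans (nrmM _ _)) // mulr_ile1 ?nrm_ge0.
have zc : z * c = c * z by rewrite /z; comm_ring.
have pz : Pos z by apply: PosZ; rewrite ?invr_ge0 ?(ltW K0).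
have zmC m : z * (1 + z) ^+ m = (1 + z) ^+ m * z.
  by apply: commrX; apply: commrD => //; exact: commr1.
have cmC m : c * (1 + z) ^+ m = (1 + z) ^+ m * c.
  by apply: commrX; apply: commrD => //; exact: commr1.
(* Bernoulli's inequality. *)
have pm m : Pos ((1 + z) ^+ m - 1 - rsc m%:R * z).
  elim: m => [|m IH]; first by rewrite expr0 rsc0 mul0r subrr subr0; exact: Pos0.
  have -> : (1 + z) ^+ m.+1 - 1 - rsc m.+1%:R * z =
    (1 + z) * ((1 + z) ^+ m - 1 - rsc m%:R * z) + rsc m%:R * (z * z).
    rewrite exprS -natr1 rscD rsc1.
    have -> : (1 + z) * ((1 + z) ^+ m - 1 - rsc m%:R * z) = (1 + z) * (1 + z) ^+ m - 1 - z
       - rsc m%:R * z - (z * rsc m%:R) * z by nc_ring.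
    by rewrite -rscC; nc_ring.
  apply: PosD; last by apply: PosZ => //; apply: Pos_sq; exact: Pos_sa.
  apply: PosM => //; last by apply: PosD => //; exact: Pos1.
  by have h := zmC m; comm_ring.
(* [m c z] is dominated by [c (1 + z)^m = - y^* f^m y], which stays bounded as [f] is a contraction.
   Letting [m] grow gives [c z = 0]. *)
have bound m : m%:R * nrm (c * z) <= nrm y * nrm y.
  have pcz : Pos (c * z) by apply: PosM.
  have -> : m%:R * nrm (c * z) = nrm (rsc m%:R * (c * z)).
    by rewrite /rsc -scalerAl mul1r nrmZ ger0_norm.
  apply: (@le_trans _ _ (nrm (c * (1 + z) ^+ m))).
    apply: Pos_le_nrm; first exact: PosZ.
    have -> : c * (1 + z) ^+ m - rsc m%:R * (c * z) = c * ((1 + z) ^+ m - 1 - rsc m%:R * z) + c.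
      rewrite mulrA rscC; nc_ring.
    apply: PosD => //; apply: PosM => //.
    by have h1 := cmC m; comm_ring.
  have -> : c * (1 + z) ^+ m = - (star y * (f ^+ m * y)).
    by rewrite fmy mulrA yy mulNr opprK.
  rewrite nrmN (le_trans (nrmM _ _)) // nrm_star ler_wpM2l ?nrm_ge0 //.
  by rewrite (le_trans (nrmM _ _)) // ler_piMl ?nrm_ge0.
have cz0 : c * z = 0.
  apply: nrm_eq0; rewrite leNgt; apply/negP => cz.
  have := bound (Num.bound (nrm y * nrm y / nrm (c * z))).
  rewrite -ler_pdivlMr // leNgt => /negP; apply.
  by apply: archi_boundP; rewrite divr_ge0 ?mulr_ge0 ?nrm_ge0.
apply: sa_eq0; first exact: Pos_sa.
have -> : c * c = rsc K * (c * z).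
  rewrite /z [c * (rsc _ * c)]mulrA -rscC -[rsc _ * c * c]mulrA mulrA.
  by rewrite [rsc K * _]rscC KK mul1r.
by rewrite cz0 mulr0.
Qed.

(** If [q] is the negative part of [x^* x], then [(x q)^* (x q) = - q^3], so [q^3 = 0] by the
    previous lemma. *)
Lemma star_mul_Pos x : Pos (star x * x).
Proof.
set b := star x * x; have sb : star b = b by rewrite starMr starK.
have [pp pq pq0 bC] := ppartP sb; set p := ppart b in pp pq pq0 bC.
set q := p - b in pq pq0.
have sq : star q = q by exact: Pos_sa.
have qp0 : q * p = 0 by rewrite -sq -(Pos_sa pp) -starMr pq0 star0.
have q3 : Pos (q * q * q) by apply: PosM; [rewrite mulrA|exact: Pos_sq|].
have q30 : q * q * q = 0.
  apply: (star_mul_neg_eq0 (y := x * q)) => //.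
  rewrite starMr sq.
  have -> : q * star x * (x * q) = q * b * q by rewrite /b; nc_ring.
  have -> : b = p - q by rewrite /q; nc_ring.
  by rewrite [q * (p - q)]mulrBr qp0; nc_ring.
have qq : q * q = 0 by apply: sa_eq0; rewrite ?starMr ?sq // mulrA q30 mul0r.
have q0 : q = 0 by exact: sa_eq0.
by have -> : b = p by rewrite -[LHS](subKr p) -/q q0 subr0.
Qed.

Lemma Pos_positive a : positive a <-> Pos a.
Proof.
split=> [[b ->]|/Pos_sqrt[c [sc cc _ _]]]; first exact: star_mul_Pos.
by exists c; rewrite sc cc.
Qed.

Lemma Pos_conj x a : Pos a -> Pos (star x * a * x).
Proof.
move=> /Pos_sqrt[c [sc <- _ _]].
by have -> : star x * (c * c) * x = star (c * x) * (c * x);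
  [rewrite starMr sc; nc_ring|exact: star_mul_Pos].
Qed.

Lemma Pos_conj' x a : Pos a -> Pos (x * a * star x).
Proof. by move=> /(Pos_conj (star x)); rewrite starK. Qed.

Lemma Pos_conj_sa x a : star x = x -> Pos a -> Pos (x * a * x).
Proof. by move=> sx /(Pos_conj x); rewrite sx. Qed.

Section Layer.
Variables (b : A) (s : R).
Hypotheses (sb : star b = b) (s0 : 0 < s).
Let u := b - rsc s.
Let su : star u = u. Proof. by rewrite starB star_rsc sb. Qed.

Lemma sa_shift : star (b - rsc s) = b - rsc s. Proof. exact: su. Qed.

Lemma comm2_shift : comm2 b u. Proof. by move=> z zb; rewrite /u; comm_ring. Qed.

Lemma comm2_ppart_shift : comm2 b (ppart u).
Proof. by have [_ _ _ uC] := ppartP su; exact: comm2_trans comm2_shift uC. Qed.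

Lemma ppart_comm_shift : ppart b * ppart u = ppart u * ppart b.
Proof.
have [_ _ _ bC] := ppartP sb; apply/esym/bC/esym/comm2_ppart_shift; exact: erefl.
Qed.

(** Let [n] be the negative part and [w = ppart u]. Computing [n b w] in two ways gives
    [n^2 w + n w^2 + s n w = 0], a sum of positive elements, so [s n w = 0]. *)
Lemma npart_ppart_shift : (ppart b - b) * ppart u = 0.
Proof.
have [pb nb pn0 bC] := ppartP sb; have [pu nu pnu0 uC] := ppartP su.
set n := ppart b - b in nb pn0 *; set w := ppart u in pu pnu0 *.
have bw : b * w = w * b by apply: comm2_ppart_shift.
have nw : n * w = w * n by have h := ppart_comm_shift; rewrite /n /w; comm_ring.
have np0 : n * ppart b = 0 by rewrite -(Pos_sa nb) -(Pos_sa pb) -starMr pn0 star0.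
have pe : Pos (n * w) by exact: PosM.
have nb' : n * b = - (n * n).
  have {1}-> : b = ppart b - n by rewrite /n; nc_ring.
  by rewrite [n * (_ - n)]mulrBr np0 sub0r.
have wb : w * b = w * w + w * rsc s.
  have -> : w * w = w * u by apply/eqP; rewrite -subr_eq0 -mulrBr pnu0.
  by rewrite -mulrDr; congr (_ * _); rewrite /u; nc_ring.
have e1 : n * (n * w) + n * w * w + rsc s * (n * w) = 0.
  rewrite rscC.
  have -> : n * (n * w) + n * w * w + n * w * rsc s = n * (n * w) + n * (w * w + w * rsc s).
    by nc_ring.
  by rewrite -wb -bw [n * (b * w)]mulrA nb'; nc_ring.
have p1 : Pos (n * (n * w) + n * w * w).
  apply: PosD; last by apply: PosM => //; comm_ring.
  by apply: PosM => //; rewrite -mulrA -nw.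
have se0 : rsc s * (n * w) = 0.
  by apply: (@Pos_add_eq0 _ _ _ (n * (n * w) + n * w * w)) => //;
    [exact: PosZ (ltW s0) _|rewrite addrC].
have ss : rsc s^-1 * rsc s = 1 by rewrite -rscM mulVf ?rsc1 // lt0r_neq0.
by rewrite -[LHS]mul1r -ss -mulrA se0 mulr0.
Qed.

Lemma ppart_mul_shift : ppart b * ppart u = b * ppart u.
Proof. by apply/eqP; rewrite -subr_eq0 -mulrBl npart_ppart_shift. Qed.

(** Divided by [s], the layer is thus a local unit for what lies above it; all local units used
    later arise in this way. *)
Lemma layer_unit : (ppart b - ppart u) * ppart u = rsc s * ppart u.
Proof.
have [_ _ pnu0 _] := ppartP su.
have wu : ppart u * u = ppart u * ppart u.
  by apply/esym/eqP; rewrite -subr_eq0 -mulrBr pnu0.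
rewrite mulrBl ppart_mul_shift -wu.
have [_ _ _ uC] := ppartP su; rewrite -(comm2_comm uC) -mulrBl; congr (_ * _).
by rewrite /u; nc_ring.
Qed.

(** By [layer_unit], the negative part [e] of the layer satisfies [s e w + e^2 w = 0] for
    [w = ppart u], so [e w = 0]. Then [e^2 + e (ppart b) = 0], and [e = 0]. *)
Lemma layer_ge0 : Pos (ppart b - ppart u).
Proof.
have [pb nb pn0 bC] := ppartP sb; have [pu nu pnu0 uC] := ppartP su.
set m := ppart b - ppart u.
have sm : star m = m by rewrite starB !Pos_sa.
have [pm ne pne0 mC] := ppartP sm; set e := ppart m - m in ne pne0.
have mu : m * ppart u = rsc s * ppart u by exact: layer_unit.
have mb : m * ppart b = ppart b * m.
  by have h := ppart_comm_shift; rewrite /m; comm_ring.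
have mw : m * ppart u = ppart u * m.
  by have h := ppart_comm_shift; rewrite /m; comm_ring.
have eb : e * ppart b = ppart b * e.
  by have h := mC _ (esym mb); rewrite /e; comm_ring.
have ew : e * ppart u = ppart u * e.
  by have h := mC _ (esym mw); rewrite /e; comm_ring.
have ep0 : e * ppart m = 0 by rewrite -(Pos_sa ne) -(Pos_sa pm) -starMr pne0 star0.
have em : e * m = - (e * e).
  by have {1}-> : m = ppart m - e; [rewrite /e; nc_ring|rewrite mulrBr ep0 sub0r].
have ew0 : e * ppart u = 0.
  have h : rsc s * (e * ppart u) + e * (e * ppart u) = 0.
    rewrite [rsc s * _]mulrA rscC -[e * rsc s * _]mulrA -mu [e * (m * _)]mulrA em; nc_ring.
  have p1 : Pos (e * ppart u) by exact: PosM.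
  have se0 : rsc s * (e * ppart u) = 0.
    apply: Pos_add_eq0 h; first exact: PosZ (ltW s0) _.
    by apply: PosM => //; rewrite -mulrA -ew.
  have ss : rsc s^-1 * rsc s = 1 by rewrite -rscM mulVf ?rsc1 // lt0r_neq0.
  by rewrite -[LHS]mul1r -ss -mulrA se0 mulr0.
have ee : e * e = 0.
  apply: (@Pos_add_eq0 _ _ _ (e * ppart b)); [exact: Pos_sq (Pos_sa ne)|exact: PosM|].
  by rewrite -[e * e]opprK -em mulrBr ew0 subr0 addNr.
have e0 : e = 0 by apply: sa_eq0 => //; exact: Pos_sa.
by have -> : m = ppart m by rewrite -[LHS](subKr (ppart m)) -/e e0 subr0.
Qed.

End Layer.

(** This is [layer_ge0] for [s - b], whose layer is [s] minus that of [b]. *)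
Lemma layer_le b s : star b = b -> 0 < s -> Pos (rsc s - (ppart b - ppart (b - rsc s))).
Proof.
move=> sb s0; have := @layer_ge0 (- (b - rsc s)) s _ s0.
have -> : - (b - rsc s) - rsc s = - b by nc_ring.
rewrite !ppartN starN starB star_rsc sb => /(_ erefl).
by congr Pos; nc_ring.
Qed.

Lemma ppart_Pos b : Pos b -> ppart b = b.
Proof.
move=> pb; have sb := Pos_sa pb; have [pp pn pn0 bC] := ppartP sb.
apply/eqP; rewrite -subr_eq0; apply/eqP; set n := ppart b - b in pn pn0 *.
have bn : b * n = n * b by have h := comm2_comm bC; rewrite /n; comm_ring.
apply: sa_eq0; first exact: Pos_sa.
apply: (@Pos_add_eq0 _ _ _ (b * n)); [exact: Pos_sq (Pos_sa pn)|exact: PosM|].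
rewrite -mulrDl; have -> : n + b = ppart b by rewrite /n subrK.
exact: pn0.
Qed.

Lemma ppart_neg b : Pos (- b) -> ppart b = 0.
Proof. by move=> /ppart_Pos; rewrite ppartN => h; rewrite -[LHS](subrK b) h addNr. Qed.

(** The positive part [e] of [d - s] satisfies [e (e + s) = d e], so inverting [e + s] exhibits [e]
    as a right multiple of [d]. *)
Lemma mul_ppart_shift_eq0 d z s : Pos d -> 0 < s -> z * d = 0 ->
  z * ppart (d - rsc s) = 0.
Proof.
move=> pd s0 zd; have sd := Pos_sa pd.
have su : star (d - rsc s) = d - rsc s by exact: sa_shift.
have [pe _ e0 eC] := ppartP su; set e := ppart _ in pe e0 eC *.
have de : d * e = e * d by have h := comm2_ppart_shift s sd; exact: h.
have [i [_ i2 _ _]] := pos_inv pe s0.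
rewrite -[LHS]mulr1 -i2 mulrA -[z * e * _]mulrA.
have -> : e * (e + rsc s) = d * e.
  by rewrite de; apply/eqP; rewrite -subr_eq0 -mulrBr -e0; apply/eqP; congr (_ * _); nc_ring.
by rewrite !mulrA zd !mul0r.
Qed.

(* Polar decomposition against a dominated element: [w] is the limit of
   [x (d + 1/n)^-1 y^(1/2)], where [d = (x^* x)^(1/2)]. *)
Lemma polar_dominated y x : Pos y -> Pos (star x * x - y) ->
  exists w, star w * w = y /\ forall h, h * x = x -> h * w = w.
Proof.
move=> py pry; have [sd dd _ pd] := psqrtP (star_mul_Pos x).
set d := psqrt _ in sd dd pd; have [sv vv _ _] := psqrtP py; set v := psqrt y in sv vv.
have eps0 n : 0 < n.+1%:R^-1 :> R by rewrite invr_gt0.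
have /choice[i iP] n := pos_inv pd (eps0 n).
have si n : star (i n) = i n by have [_ _ /Pos_sa] := iP n.
have id_ n : d * i n = i n * d by have [_ _ _ h] := iP n; exact: h.
have dE n : 1 - d * i n = rsc n.+1%:R^-1 * i n.
  by have [_ <- _ _] := iP n; nc_ring.
have di1 n : nrm (d * i n) <= 1.
  have [_ _ pi _] := iP n.
  apply: Pos_nrm_le; first exact: PosM.
  by rewrite rsc1 dE; apply: PosZ => //; exact: ltW.
(* Here [y <= d^2] enters: [(i v) (i v)^* = i y i <= i d^2 i], and [d i] is a contraction. *)
have iv1 n : nrm (i n * v) <= 1.
  rewrite -(@expr_le1 _ 2) ?nrm_ge0 // -nrm_star -nrm_starM starK starMr si sv.
  have -> : i n * v * (v * i n) = i n * y * i n by rewrite -vv; nc_ring.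
  apply: (@le_trans _ _ (nrm (i n * (d * d) * i n))).
    apply: Pos_le_nrm; first exact: Pos_conj_sa.
    have -> : i n * (d * d) * i n - i n * y * i n = i n * (d * d - y) * i n by nc_ring.
    by apply: Pos_conj_sa => //; rewrite dd.
  have -> : i n * (d * d) * i n = (i n * d) * (d * i n) by nc_ring.
  by rewrite -id_ (le_trans (nrmM _ _)) // mulr_ile1 ?nrm_ge0.
have divv n : nrm (d * i n * v - v) <= n.+1%:R^-1.
  have -> : d * i n * v - v = - ((1 - d * i n) * v) by nc_ring.
  rewrite nrmN dE -mulrA (le_trans (nrmM _ _)) // nrm_rsc gtr0_norm //.
  by rewrite ger_pMr.
have divl : ncvg (fun n => d * i n * v) v.
  move=> e e0; exists (Num.bound e^-1) => n hn; rewrite (le_trans (divv n)) //.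
  rewrite invf_ple ?posrE // (le_trans (ltW (archi_boundP _))) ?invr_ge0 ?(ltW e0) //.
  by rewrite ler_nat (leq_trans hn).
(* Since [x^* x = d^2], the sequence [x i v] is Cauchy because [d i v] is. *)
have wd z : nrm (x * z) = nrm (d * z).
  apply/eqP; rewrite -(@eqrXn2 _ 2) ?nrm_ge0 // -!nrm_starM !starMr sd.
  by apply/eqP; congr nrm; rewrite -!mulrA; congr (_ * _); rewrite !mulrA dd.
have [w hw] : exists w, ncvg (fun n => x * (i n * v)) w.
  apply: cauchy_ncvg => e e0; have [N hN] := divl _ (divr_gt0 e0 (ltr0Sn R 1)).
  exists N => n m Nn nm; rewrite -mulrBr wd mulrBr !mulrA.
  rewrite (le_trans (nrm_subD _ v _)) // [leRHS]splitr lerD ?hN ?(leq_trans Nn) //.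
  by rewrite nrm_subC hN.
exists w; split.
  apply: (ncvg_uniq (ncvgM (ncvg_star hw) hw)); have -> : y = star v * v by rewrite sv.
  apply: ncvg_eq (ncvgM (ncvg_star divl) divl) => n.
  rewrite !starMr sd si sv -!mulrA; congr (_ * (_ * _)); rewrite !mulrA dd //.
move=> h hr; apply: (ncvg_uniq (ncvgMl h hw)); apply: ncvg_eq hw => n.
by rewrite [RHS]mulrA hr.
Qed.

End StarMul.

(** * Monotonicity of quasitraces *)

Section Qtrace.
Variables (R : realType) (A : cstarAlgType R).
Implicit Types (x y z a b c d h : A) (r s t e : R).
Local Notation rsc := (rsc A).

Lemma mul_sq_eq0 v z : star v = v -> z * (v * v) = 0 -> z * v = 0.
Proof.
move=> sv zd; have h : v * star z = 0.
  apply: star_mul_eq0; rewrite starMr starK sv.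
  have -> : z * v * (v * star z) = z * (v * v) * star z by nc_ring.
  by rewrite zd mul0r.
by rewrite -[z]starK -sv -starMr h star0.
Qed.

Lemma mul_psqrt_eq0 d z : Pos d -> z * d = 0 -> z * psqrt d = 0.
Proof. by move=> /psqrtP[sv vv _ _]; rewrite -{1}vv; exact: mul_sq_eq0. Qed.

(* The real part of a quasitrace; the extension to 2x2 matrices plays no role. *)
Record qtrace (T : A -> R) : Prop := Qtrace {
  qt_tr : forall x, T (star x * x) = T (x * star x);
  qt_sq_ge0 : forall x, 0 <= T (star x * x);
  qtD : forall a b, star a = a -> star b = b -> a * b = b * a -> T (a + b) = T a + T b;
  qtZ : forall r a, star a = a -> T (rsc r * a) = r * T a;
  qt1 : T 1 = 1 }.

Variable T : A -> R.
Hypothesis qT : qtrace T.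

Lemma qt_ge0 a : Pos a -> 0 <= T a.
Proof. by move=> /Pos_positive[b ->]; exact: (qt_sq_ge0 qT). Qed.

Lemma qt_rsc r : T (rsc r) = r.
Proof. by rewrite -[rsc r]mulr1 (qtZ qT) ?star1 // (qt1 qT) mulr1. Qed.

Lemma qtB a b : star a = a -> star b = b -> a * b = b * a -> T (a - b) = T a - T b.
Proof.
move=> sa sb ab; rewrite -[in RHS](subrK b a) (qtD qT (a := a - b)) ?addrK //.
  by rewrite starB sa sb.
comm_ring.
Qed.

Lemma qt_le_comm a b : star a = a -> star b = b -> a * b = b * a -> Pos (b - a) -> T a <= T b.
Proof. by move=> sa sb ab /qt_ge0; rewrite qtB // subr_ge0. Qed.

(** Polar decomposition gives [y = w^* w] with [h w = w]. Then [w w^*] has the trace and norm of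
    [y], commutes with [h] and lies below [nrm y] times [h^2], so monotonicity for commuting
    elements suffices. *)
Lemma qt_le_unit x y h : Pos y -> Pos (star x * x - y) -> star h = h -> h * x = x ->
  T y <= nrm y * T (h * h).
Proof.
move=> py pxy sh hx; have [w [wy /(_ _ hx) hw]] := polar_dominated py pxy.
rewrite -wy (qt_tr qT) wy; set z := w * star w.
have hz : h * z = z by rewrite mulrA hw.
have sz : star z = z by rewrite starMr starK.
have zh : z * h = z by rewrite -sz -{1}sh -starMr hz.
have nz : nrm z = nrm y.
  by rewrite /z -{1}[w]starK nrm_starM nrm_star -nrm_starM wy.
rewrite -(qtZ qT); last by rewrite starMr sh.
apply: qt_le_comm => //.
- by rewrite !starMr star_rsc sh rscC.
- have zh' : z * h = h * z by rewrite zh hz.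
  comm_ring.
have -> : rsc (nrm y) * (h * h) - z = h * (rsc (nrm y) - z) * h.
  by rewrite mulrBr mulrBl hz zh -rscC -!mulrA.
by apply: Pos_conj_sa => //; apply: Pos_sub_nrm => //; rewrite nz.
Qed.

(* With [f_k = ppart (c - k s)], the layer [f_1 - f_2] lives where [f_0 >= s]. *)
Lemma layer_cube c s (q := ppart c) (w1 := ppart (c - rsc s))
    (w2 := ppart (c - rsc s - rsc s)) : star c = c -> 0 < s ->
  Pos (q * q * q - rsc (s ^+ 2) * (w1 - w2)).
Proof.
move=> sc s0; have su := sa_shift s sc.
have ss : c - rsc s - rsc s = c - rsc (s + s) by rewrite rscD; nc_ring.
have [pq _ _ _] := ppartP sc; have [p1 _ _ _] := ppartP su.
have [p2 _ _ _] := ppartP (sa_shift s su).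
rewrite -/q -/w1 -/w2 in pq p1 p2.
have qw1 : q * w1 = w1 * q by exact: ppart_comm_shift.
have qw2 : q * w2 = w2 * q by rewrite /w2 ss; exact: ppart_comm_shift.
have w12 : w1 * w2 = w2 * w1 by exact: ppart_comm_shift.
have qy : q * (w1 - w2) = w1 * (w1 - w2) + rsc s * (w1 - w2).
  have e1 : q * w1 = w1 * w1 + rsc s * w1.
    by rewrite -(layer_unit sc s0) -/q -/w1; nc_ring.
  have e2 : q * w2 = w1 * w2 + rsc s * w2.
    rewrite {1}/w1 /w2 (ppart_mul_shift su s0) ss.
    by rewrite (ppart_mul_shift sc (addr_gt0 s0 s0)) -mulrDl subrK.
  by rewrite mulrBr e1 e2; nc_ring.
set y := w1 - w2 in qy *.
have py : Pos y by exact: layer_ge0.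
have pys : Pos (rsc s - y) by exact: layer_le.
have yq : y * q = q * y by rewrite /y; comm_ring.
have yw1 : y * w1 = w1 * y by rewrite /y; comm_ring.
have pqq : Pos (q * q) by apply: Pos_sq; exact: Pos_sa.
have h1 : Pos (q * q * q * (rsc s - y)) by apply: PosM => //; [comm_ring|apply: PosM => //; comm_ring].
have h2 : Pos (w1 * y * (q * q + rsc s * q + rsc (s ^+ 2))).
  apply: PosM; [comm_ring|exact: PosM|].
  apply: PosD; last by apply: Pos_rsc; exact: sqr_ge0.
  by apply: PosD => //; apply: PosZ (ltW s0) _.
have s0' : rsc s^-1 * rsc s = 1 by rewrite -rscM mulVf ?rsc1 // lt0r_neq0.
(* Multiplied by [s], the left side is [q^3 (s - y) + (q^3 - s^3) y], where [q^3 - s^3] has the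
   factor [q - s] and [(q - s) y = w1 y] is positive. *)
have -> : q * q * q - rsc (s ^+ 2) * y = rsc s^-1 *
    (q * q * q * (rsc s - y) + w1 * y * (q * q + rsc s * q + rsc (s ^+ 2))).
  have -> : w1 * y = q * y - rsc s * y by rewrite qy; nc_ring.
  rewrite -[LHS]mul1r -s0' -mulrA; congr (_ * _); rewrite expr2 rscM.
  set D := rsc s; have DC z : z * D = D * z by rewrite /D rscC.
  have e1 : q * y * D = D * (y * q) by rewrite DC yq.
  have e2 : D * y * D = D * (D * y) by rewrite DC.
  have e3 : q * q * q * D = D * (q * q * q) by rewrite DC.
  have e4 : q * q * q * y = y * (q * q * q) by comm_ring.
  have -> : q * q * q * (D - y) + (q * y - D * y) * (q * q + D * q + D * D) =
     q * q * q * D - q * q * q * y + q * y * q * q + q * y * D * q - D * y * q * q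
     - D * y * D * q + q * y * D * D - D * y * D * D by nc_ring.
  rewrite e1 e2 e3 e4 -[D * (y * q) * D]mulrA [y * q * D]DC -[D * (D * y) * D]mulrA e2 -yq.
  nc_ring.
by apply: PosZ; [rewrite invr_ge0 ltW|exact: PosD].
Qed.

(* [f_0 c f_0 = f_0^3] dominates the layer of [c] and is itself dominated by
   [f_0 (ppart d) f_0 = x^* x], where [x] has the normalized layer of [d] as a
   left unit. *)
Lemma qt_layer c d s : star c = c -> star d = d -> Pos (d - c) -> 0 < s ->
  T (ppart (c - rsc s)) - T (ppart (c - rsc s - rsc s)) <=
  T (ppart (d + rsc s)) - T (ppart d).
Proof.
move=> sc sd pdc s0.
have sc1 := sa_shift s sc; have sc2 := sa_shift s sc1.
have [pq _ q0 _] := ppartP sc; have [p1 _ _ _] := ppartP sc1.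
have [p2 _ _ _] := ppartP sc2.
have sds : star (d + rsc s) = d + rsc s by rewrite starD star_rsc sd.
have dE : d + rsc s - rsc s = d by nc_ring.
have [pd pnd _ _] := ppartP sd; have [pds _ _ _] := ppartP sds.
have s0' : rsc s^-1 * rsc s = 1 by rewrite -rscM mulVf ?rsc1 // lt0r_neq0.
have := layer_cube sc s0; set q := ppart c in pq q0 *.
set y := ppart (c - rsc s) - _ => pcube.
have py : Pos y by exact: layer_ge0.
have ny : nrm y <= s by apply: Pos_nrm_le => //; exact: layer_le.
set k := ppart (d + rsc s) - ppart d.
have dsd : ppart (d + rsc s) * ppart d = ppart d * ppart (d + rsc s).
  by have := ppart_comm_shift s sds; rewrite dE.
have pk : Pos k by rewrite /k -{2}dE; exact: layer_ge0.
have pk' : Pos (rsc s - k) by rewrite /k -{2}dE; exact: layer_le.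
have kd : k * ppart d = rsc s * ppart d by have := layer_unit sds s0; rewrite dE.
pose h := rsc s^-1 * k.
have ph : Pos h by apply: PosZ; rewrite ?invr_ge0 ?ltW.
have hd : (1 - h) * ppart d = 0.
  by rewrite mulrBl mul1r /h -mulrA kd mulrA s0' mul1r subrr.
have hv : h * psqrt (ppart d) = psqrt (ppart d).
  have := mul_psqrt_eq0 pd hd; rewrite mulrBl mul1r => /eqP; rewrite subr_eq0 => /eqP //.
have [sv vv _ _] := psqrtP pd; set v := psqrt _ in sv vv hv.
(* With this scaling [s^2 x^* x = q (ppart d) q], which dominates [q d q], then [q c q = q^3], then
   [s^2 y]. *)
pose x := rsc s^-1 * (v * q).
have hx : h * x = x.
  by rewrite /x mulrA -rscC -[LHS]mulrA [h * (v * q)]mulrA hv.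
have xx : star x * x = rsc (s^-1 ^+ 2) * (q * ppart d * q).
  rewrite /x [star (rsc _ * _)]starMr [star (v * q)]starMr star_rsc sv (Pos_sa pq) expr2 rscM -vv -rscC.
  have -> : rsc s^-1 * (q * v) * (rsc s^-1 * (v * q)) = rsc s^-1 * ((q * v * rsc s^-1) * (v * q)) by nc_ring.
  by rewrite -rscC; nc_ring.
have pxy : Pos (star x * x - y).
  have -> : star x * x - y = rsc (s^-1 ^+ 2) *
      (q * (ppart d - d) * q + q * (d - c) * q + (q * q * q - rsc (s ^+ 2) * y)).
    have -> : q * (ppart d - d) * q + q * (d - c) * q + (q * q * q - rsc (s ^+ 2) * y) =
      q * ppart d * q + q * (q - c) * q - rsc (s ^+ 2) * y by nc_ring.
    rewrite q0 mul0r addr0 mulrBr -xx [rsc (s^-1 ^+ 2) * (rsc _ * _)]mulrA -rscM -exprMn.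
    by rewrite mulVf ?lt0r_neq0 // expr1n rsc1 mul1r.
  apply: PosZ; first exact: sqr_ge0.
  by do 2?[apply: PosD => //]; apply: Pos_conj_sa => //; exact: Pos_sa.
have sh := Pos_sa ph.
have Ty := qt_le_unit py pxy sh hx.
have Th : T (h * h) <= T h.
  apply: qt_le_comm => //; first by rewrite starMr sh.
    by rewrite mulrA.
  have -> : h - h * h = h * (1 - h) by nc_ring.
  apply: PosM => //; first by comm_ring.
  have -> : 1 - h = rsc s^-1 * (rsc s - k) by rewrite mulrBr s0'.
  by apply: PosZ; rewrite ?invr_ge0 ?ltW.
have Thh : 0 <= T (h * h) by apply: qt_ge0; exact: Pos_sq.
rewrite -!qtB ?(Pos_sa p1) ?(Pos_sa p2) ?(Pos_sa pd) ?(Pos_sa pds) //; last first.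
  exact: ppart_comm_shift.
rewrite -/y -/k.
have -> : T k = s * T h by rewrite /h (qtZ qT) ?(Pos_sa pk) // mulrA divff ?mul1r // lt0r_neq0.
rewrite (le_trans Ty) // (le_trans (ler_wpM2r Thh ny)) //.
by rewrite ler_wpM2l // ltW.
Qed.

Lemma qt_le_Pos a b : Pos a -> Pos (b - a) -> T a <= T b.
Proof.
move=> pa pba; have sa := Pos_sa pa.
have pb : Pos b by rewrite -(subrK a b); exact: PosD.
have sb := Pos_sa pb.
(* Layer [k + 2] of [a] is compared with layer [k] of [b]. The two bottom layers of [a] remain
   unmatched and cost at most [s] each, whence [s = e / 2]. *)
apply/ler_addgt0Pr => e e0; pose s := e / 2; have s0 : 0 < s by rewrite divr_gt0.
pose lev c k := c - rsc (s *+ k).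
have lev_sa c k : star c = c -> star (lev c k) = lev c k by exact: sa_shift.
have levS c k : lev c k - rsc s = lev c k.+1.
  by rewrite /lev mulrSr rscD opprD addrA.
have lev0 c : lev c 0 = c by rewrite /lev mulr0n rsc0 subr0.
pose F c k := T (ppart (lev c k)).
have F_ge0 c k : star c = c -> 0 <= F c k.
  by move=> sc; have [p _ _ _] := ppartP (lev_sa _ k sc); exact: qt_ge0.
have F_step c k : star c = c -> F c k - F c k.+1 <= s.
  move=> sc; have sl := lev_sa _ k sc; rewrite /F -levS.
  have [p _ _ _] := ppartP sl; have [p' _ _ _] := ppartP (sa_shift s sl).
  rewrite -qtB ?(Pos_sa p) ?(Pos_sa p') //; last exact: ppart_comm_shift.
  rewrite -[leRHS](qt_rsc s); apply: qt_le_comm; rewrite ?star_rsc ?starB ?(Pos_sa p) ?(Pos_sa p') //.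
    by rewrite rscC.
  exact: layer_le.
have F_le k : F a k.+2 - F a k.+3 <= F b k - F b k.+1.
  have := @qt_layer (lev a k.+1) (lev b k.+1) s (lev_sa _ _ sa) (lev_sa _ _ sb) _ s0.
  rewrite !levS; have -> : lev b k.+1 + rsc s = lev b k by rewrite -levS subrK.
  by apply; rewrite /lev; have -> : b - rsc (s *+ k.+1) - (a - rsc (s *+ k.+1)) = b - a by nc_ring.
have F_sum n : F a 2 - F a n.+2 <= F b 0 - F b n.
  elim: n => [|n IH]; first by rewrite !subrr.
  have := F_le n; lra.
have Fa0 : T a = F a 0 by rewrite /F lev0 ppart_Pos.
have Fb0 : T b = F b 0 by rewrite /F lev0 ppart_Pos.
(* Above height [nrm a] the positive part of the shifted [a] vanishes, so finitely many layers
   exhaust [a]. *)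
pose n := Num.bound (nrm a / s).
have Fan : F a n.+2 = 0.
  rewrite /F ppart_neg ?opprB; first by rewrite -(rsc0 A) qt_rsc.
  apply: Pos_sub_nrm => //; rewrite -mulr_natl -ler_pdivrMr // ltW //.
  rewrite (lt_le_trans (archi_boundP (divr_ge0 (nrm_ge0 a) (ltW s0)))) //.
  by rewrite ler_nat /n leqW.
have := F_sum n; have := F_ge0 b n sb; have := F_step a 0%N sa; have := F_step a 1%N sa.
rewrite -Fa0 -Fb0 Fan /s; lra.
Qed.

Lemma qt_le a b : star a = a -> star b = b -> Pos (b - a) -> T a <= T b.
Proof.
move=> sa sb pba; pose K := nrm a.
have := @qt_le_Pos (a + rsc K) (b + rsc K).
rewrite !(qtD qT) ?star_rsc ?rscC // lerD2r; apply.
  have -> : a + rsc K = rsc K - (- a) by nc_ring.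
  by apply: Pos_sub_nrm; rewrite ?starN ?sa ?nrmN.
by have -> : b + rsc K - (a + rsc K) = b - a by nc_ring.
Qed.

(** This takes the place of additivity whenever nearby elements need not commute. *)
Lemma qt_dist a b e : star a = a -> star b = b -> nrm (a - b) <= e -> T a <= T b + e.
Proof.
move=> sa sb h; rewrite -[e in leRHS]qt_rsc -(qtD qT) ?star_rsc ?rscC //.
apply: qt_le => //; first by rewrite starD star_rsc sb.
have -> : b + rsc e - a = rsc e - (a - b) by nc_ring.
by apply: Pos_sub_nrm; rewrite ?starB ?sa ?sb.
Qed.

End Qtrace.

(** * Elements of small trace *)

Section Bumps.
Variables (R : realType) (A : cstarAlgType R).
Implicit Types (x y z a b c d h m : A) (r s t e : R).
Local Notation rsc := (rsc A).

(** The local unit [h] carries the trace bound, while [m], once normalized, gives the test element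
    [m * m] for the Rokhlin property. *)
Definition bump_pair h m := [/\ Pos h, Pos (1 - h), star m = m, m <> 0 & h * m = m].

(** Cut [d] at half its norm: [m] is the part above, nonzero since otherwise [nrm d <= nrm d / 2],
    and [h] is the normalized layer below. The last clause expresses that [h] is supported on
    [d]. *)
Lemma bump_below d : Pos d -> d <> 0 ->
  exists h m, bump_pair h m /\ forall z, z * d = 0 -> z * h = 0.
Proof.
move=> pd d0; pose s := nrm d / 2.
have nd : 0 < nrm d by rewrite ltNge; apply/negP => /nrm_eq0.
have s0 : 0 < s by rewrite divr_gt0.
have sd := Pos_sa pd; have [pe pn _ _] := ppartP (sa_shift s sd).
have s0' : rsc s^-1 * rsc s = 1 by rewrite -rscM mulVf ?rsc1 // lt0r_neq0.
have L0 := layer_ge0 sd s0; have L1 := layer_le sd s0; have L2 := layer_unit sd s0.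
rewrite (ppart_Pos pd) in L0 L1 L2; set e := ppart _ in pe pn L0 L1 L2.
exists (rsc s^-1 * (d - e)), e; split; first split.
- by apply: PosZ; rewrite ?invr_ge0 ?ltW.
- have -> : 1 - rsc s^-1 * (d - e) = rsc s^-1 * (rsc s - (d - e)) by rewrite [RHS]mulrBr s0'.
  by apply: PosZ; rewrite ?invr_ge0 ?ltW.
- exact: Pos_sa.
- move=> e0; move: pn; rewrite e0 sub0r opprB => /(Pos_nrm_le pd).
  by rewrite /s; lra.
- by rewrite -mulrA L2 mulrA s0' mul1r.
move=> z zd; rewrite mulrA -rscC -mulrA mulrBr zd (mul_ppart_shift_eq0 pd s0 zd).
by rewrite subr0 mulr0.
Qed.

(** The scalar is the supremum of the [t] with [m (a - t) m] positive. At the supremum this element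
    and its opposite are both limits of positive elements, so it vanishes. *)
Lemma corner_order m a : star m = m -> m <> 0 -> star a = a ->
  (forall b, star b = b -> Pos (m * b * m) \/ Pos (- (m * b * m))) ->
  exists s, m * a * m = rsc s * (m * m).
Proof.
move=> sm m0 sa total.
pose D t := m * (a - rsc t) * m.
have DE t : D t = m * a * m - rsc t * (m * m).
  have -> : D t = m * a * m - m * rsc t * m by rewrite /D; nc_ring.
  by rewrite -rscC -[rsc t * m * m]mulrA.
have pmm : Pos (m * m) by exact: Pos_sq.
pose E := [set t | Pos (D t)].
(* For [t > nrm a], positivity of [D t] would make [- m^2] positive and force [m = 0]. *)
have ubE : ubound E (nrm a).
  move=> t Et; rewrite leNgt; apply/negP => lt.
  have h : Pos (m * (rsc (nrm a) - a) * m).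
    by apply: Pos_conj_sa => //; exact: Pos_sub_nrm.
  have h1 : Pos (- (rsc (t - nrm a) * (m * m))).
    have -> : - (rsc (t - nrm a) * (m * m)) = D t + m * (rsc (nrm a) - a) * m.
      rewrite DE mulrBr mulrBl -rscC -[rsc (nrm a) * m * m]mulrA rscD rscN; nc_ring.
    exact: PosD.
  have h2 : Pos (rsc (t - nrm a) * (m * m)) by apply: PosZ => //; rewrite subr_ge0 ltW.
  have h3 := Pos_anti h2 h1; apply: m0; apply: sa_eq0 => //.
  have tt : (t - nrm a)^-1 * (t - nrm a) = 1 by rewrite mulVf // subr_eq0 gt_eqF.
  by rewrite -[LHS]mul1r -(rsc1 A) -tt rscM -mulrA h3 mulr0.
have hE : has_sup E.
  split; last by exists (nrm a).
  exists (- nrm a); rewrite /E /= /D; apply: Pos_conj_sa => //.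
  have -> : a - rsc (- nrm a) = rsc (nrm a) - (- a) by rewrite rscN; nc_ring.
  by apply: Pos_sub_nrm; rewrite ?nrmN // starN sa.
have close t t' : nrm (D t - D t') = `|t - t'| * nrm (m * m).
  have -> : D t - D t' = rsc (t' - t) * (m * m) by rewrite !DE rscD rscN; nc_ring.
  by rewrite /rsc -scalerAl mul1r nrmZ distrC.
have mm1 : 0 < nrm (m * m) + 1 by rewrite ltr_wpDl ?nrm_ge0.
have closeE e t t' : 0 < e -> `|t - t'| <= e / (nrm (m * m) + 1) -> nrm (D t - D t') <= e.
  move=> e0 h; rewrite close (le_trans (ler_wpM2r (nrm_ge0 _) h)) //.
  by rewrite -mulrA ger_pMr // ler_pdivrMl // mulr1 lerDl.
exists (sup E); apply/eqP; rewrite -subr_eq0 -DE; apply/eqP; apply: Pos_anti.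
  apply: Pos_closed => e e0.
  have d0 : 0 < e / (nrm (m * m) + 1) by rewrite divr_gt0.
  have [t Et lt] := sup_adherent d0 hE; exists (D t) => //.
  apply: closeE => //; have := ub_le_sup (proj2 hE) Et => le.
  by rewrite ger0_norm ?subr_ge0 //; lra.
apply: Pos_closed => e e0.
pose d := e / (nrm (m * m) + 1); have d0 : 0 < d by rewrite divr_gt0.
exists (- D (sup E + d)).
  have [h|//] := total (a - rsc (sup E + d)) (sa_shift _ sa).
  have := ub_le_sup (proj2 hE) (h : E _); lra.
rewrite -opprD nrmN; apply: closeE => //.
have -> : sup E - (sup E + d) = - d by ring.
by rewrite normrN ger0_norm // ltW.
Qed.

(* Otherwise [m A m] would be totally ordered, hence equal to [C m^2]; writing
   [1 = sum_i x_i m y_i] by simplicity, [A] would be spanned by the finitely many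
   [x_i m^2 y_k]. *)
Lemma corner_split m : star m = m -> m <> 0 -> simple_cstar A -> infinite_dimensional A ->
  exists a, [/\ star a = a, ~ Pos (m * a * m) & ~ Pos (- (m * a * m))].
Proof.
move=> sm m0 simpA infA; apply: contrapT => /forallNP hn.
have total b : star b = b -> Pos (m * b * m) \/ Pos (- (m * b * m)).
  move=> sb; apply: contrapT => /not_orP[h1 h2]; exact: hn b (And3 sb h1 h2).
have scal a : exists z : R[i], m * a * m = z *: (m * m).
  have [h [k [sh sk -> _]]] := cartesian a.
  have [s hs] := corner_order sm m0 sh total; have [t ht] := corner_order sm m0 sk total.
  exists (s%:C + 'i%C * t%:C).
  rewrite mulrDr mulrDl -scalerAr -scalerAl ht hs /rsc -!scalerAl !mul1r.
  by rewrite scalerA -scalerDl.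
pose S (l : seq (A * A)) := \sum_(p <- l) p.1 * m * p.2.
(* The closed ideal generated by [m]. *)
pose I := [set w | forall e, 0 < e -> exists l, nrm (w - S l) <= e].
have cI : closed_ideal I.
  split.
  - apply: metric_closed => w hw e e0; have e2 := divr_gt0 e0 (ltr0Sn R 1).
    have [w' hw' h1] := hw _ e2; have [l hl] := hw' _ e2; exists l.
    by rewrite (le_trans (nrm_subD _ w' _)) // [leRHS]splitr lerD.
  - by move=> e e0; exists [::]; rewrite /S big_nil subrr nrm0 ltW.
  - move=> w w' hw hw' e e0; have e2 := divr_gt0 e0 (ltr0Sn R 1).
    have [l hl] := hw _ e2; have [l' hl'] := hw' _ e2; exists (l ++ l').
    have -> : w + w' - S (l ++ l') = (w - S l) + (w' - S l') by rewrite /S big_cat /= opprD addrACA.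
    by rewrite (le_trans (nrmD _ _)) // [leRHS]splitr lerD.
  - move=> a w hw; have a1 : 0 < nrm a + 1 by rewrite ltr_wpDl ?nrm_ge0.
    split=> e e0; have [l hl] := hw _ (divr_gt0 e0 a1).
      exists [seq (a * p.1, p.2) | p <- l].
      have -> : a * w - S [seq (a * p.1, p.2) | p <- l] = a * (w - S l).
        rewrite /S big_map mulrBr mulr_sumr; congr (_ - _).
        by apply: eq_bigr => p _ /=; rewrite !mulrA.
      rewrite (le_trans (nrmM _ _)) // (le_trans (ler_wpM2l (nrm_ge0 a) hl)) //.
      by rewrite mulrCA ger_pMr // ler_pdivrMr // mul1r lerDl.
    exists [seq (p.1, p.2 * a) | p <- l].
    have -> : w * a - S [seq (p.1, p.2 * a) | p <- l] = (w - S l) * a.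
      rewrite /S big_map mulrBl mulr_suml; congr (_ - _).
      by apply: eq_bigr => p _ /=; rewrite !mulrA.
    rewrite (le_trans (nrmM _ _)) // mulrC (le_trans (ler_wpM2l (nrm_ge0 a) hl)) //.
    by rewrite mulrCA ger_pMr // ler_pdivrMr // mul1r lerDl.
have Im : I m.
  move=> e e0; exists [:: (1, 1)].
  by rewrite /S big_seq1 /= mulr1 mul1r subrr nrm0 ltW.
have I1 : I 1.
  have [I0|->//] := simpA _ cI.
  by move: Im; rewrite I0 => /= h; case: (m0 h).
(* A sum within [1/2] of 1 is invertible, and multiplying by its inverse gives an exact expression
   of 1. *)
have [l hl] := I1 2^-1 (ltac:(by rewrite invr_gt0)).
have [|j [_ j1 _]] := @neumann _ _ (1 - S l); first by rewrite (le_lt_trans hl) //; lra.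
apply: infA.
pose N := size l; pose q (i : 'I_N) := tnth (in_tuple l) i.
have one : 1 = \sum_(i < N) (q i).1 * m * ((q i).2 * j).
  rewrite -[LHS]j1; have -> : 1 - (1 - S l) = S l by nc_ring.
  rewrite /S big_tnth mulr_suml; apply: eq_bigr => i _; by rewrite !mulrA.
(* Writing [a = 1 a 1] with this expression on both sides leaves middle factors [m (y_i a x_k) m],
   which are scalar multiples of [m^2]. *)
exists #|{: 'I_N * 'I_N}|, (fun k => (q (enum_val k).1).1 * (m * m) * ((q (enum_val k).2).2 * j)) => a.
have [z hz] := choice (fun p : 'I_N * 'I_N => scal ((q p.1).2 * j * a * (q p.2).1)).
exists (fun k => z (enum_val k)).
rewrite -(big_enum_val (fun p => z p *: ((q p.1).1 * (m * m) * ((q p.2).2 * j)))) /=.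
rewrite (eq_bigr (fun p => z (p.1, p.2) *: ((q p.1).1 * (m * m) * ((q p.2).2 * j)))); last by case.
rewrite -(pair_bigA _ (fun i k => z (i, k) *: ((q i).1 * (m * m) * ((q k).2 * j)))) /=.
rewrite -[LHS]mul1r -[LHS]mulr1 {1}one {1}one mulr_suml mulr_suml; apply: eq_bigr => i _.
rewrite mulr_sumr; apply: eq_bigr => k _.
rewrite scalerAl scalerAr -(hz (i, k)) /=; nc_ring.
Qed.

(** An indefinite element [b = m a m] has nonzero positive and negative parts. These are orthogonal,
    [h] is a unit for both, and each supports a bump. *)
Lemma bump_split h m : bump_pair h m -> simple_cstar A -> infinite_dimensional A ->
  exists h1 m1 h2 m2, [/\ bump_pair h1 m1, bump_pair h2 m2, h1 * h2 = 0, h * h1 = h1 & h * h2 = h2].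
Proof.
move=> [ph ph1 sm m0 hm] simpA infA.
have [a [sa na nb]] := corner_split sm m0 simpA infA.
set b := m * a * m in na nb.
have sb : star b = b by rewrite /b !starMr sa sm mulrA.
have [pp pq pq0 bC] := ppartP sb.
have p0 : ppart b <> 0 by move=> e; apply: nb; move: pq; rewrite e sub0r.
have q0 : ppart b - b <> 0.
  by move=> /eqP; rewrite subr_eq0 => /eqP e; apply: na; rewrite -e.
have hb : (1 - h) * b = 0.
  by rewrite /b !mulrA mulrBl mul1r hm subrr !mul0r.
have hp : (1 - h) * ppart b = 0.
  apply: mul_sq_eq0; first exact: Pos_sa.
  have -> : ppart b * ppart b = b * ppart b.
    by rewrite (comm2_comm bC); apply/eqP; rewrite -subr_eq0 -mulrBr pq0.
  by rewrite mulrA hb mul0r.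
have hq : (1 - h) * (ppart b - b) = 0 by rewrite mulrBr hp hb subrr.
have [h1 [m1 [b1 z1]]] := bump_below pp p0; have [h2 [m2 [b2 z2]]] := bump_below pq q0.
exists h1, m1, h2, m2; split=> //.
- have [/Pos_sa s1 _ _ _ _] := b1; have [/Pos_sa s2 _ _ _ _] := b2.
  rewrite -s1 -s2 -starMr z1 ?star0 //.
  by rewrite -s2 -(Pos_sa pp) -starMr z2 ?star0.
- by apply/esym/eqP; rewrite -subr_eq0 -{1}[h1]mul1r -mulrBl z1.
- by apply/esym/eqP; rewrite -subr_eq0 -{1}[h2]mul1r -mulrBl z2.
Qed.

(** Start from [h = m = 1] and split repeatedly. As [h1^2 + h2^2 <= h^2] for the two orthogonal
    pieces, one of them has at most half the trace. *)
Lemma small_bump (T : A -> R) e : qtrace T -> simple_cstar A -> infinite_dimensional A ->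
  0 < e -> exists h m, bump_pair h m /\ T (h * h) <= e.
Proof.
move=> qT simpA infA e0.
have H n : exists h m, bump_pair h m /\ T (h * h) <= (2^-1) ^+ n.
  elim: n => [|n [h [m [bhm Th]]]].
    exists 1, 1; rewrite mulr1 (qt1 qT) expr0; split=> //; split; rewrite ?mulr1 ?star1 ?subrr //.
    - exact: Pos1.
    - exact: Pos0.
    - by apply/eqP; rewrite oner_eq0.
  have [h1 [m1 [h2 [m2 [b1 b2 h12 hh1 hh2]]]]] := bump_split bhm simpA infA.
  have [ph _ _ _ _] := bhm.
  have [p1 p1' _ _ _] := b1; have [p2 p2' _ _ _] := b2.
  have h21 : h2 * h1 = 0 by rewrite -(Pos_sa p1) -(Pos_sa p2) -starMr h12 star0.
  have c12 : h1 * h2 = h2 * h1 by rewrite h12 h21.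
  pose k := h1 + h2; have pk : Pos k by exact: PosD.
  have pk1 : Pos (1 - k).
    have -> : 1 - k = (1 - h1) * (1 - h2).
      have -> : (1 - h1) * (1 - h2) = 1 - (h1 + h2) + h1 * h2 by nc_ring.
      by rewrite h12 addr0.
    by apply: PosM => //; comm_ring.
  have sk := Pos_sa pk; have hk : h * k = k by rewrite mulrDr hh1 hh2.
  have kh : k * h = k by rewrite -{1}sk -(Pos_sa ph) -starMr hk sk.
  have kk : k * k = h1 * h1 + h2 * h2.
    by rewrite mulrDl !mulrDr h12 h21; nc_ring.
  have le : T (h1 * h1) + T (h2 * h2) <= T (h * h).
    rewrite -(qtD qT) ?starMr ?(Pos_sa p1) ?(Pos_sa p2) //; last by comm_ring.
    rewrite -kk; apply: (qt_le_comm qT); rewrite ?starMr ?sk ?(Pos_sa ph) //.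
      have hk' : h * k = k * h by rewrite hk kh.
      comm_ring.
    have -> : h * h - k * k = h * ((1 - k) * (1 + k)) * h.
      have -> : (1 - k) * (1 + k) = 1 - k * k by nc_ring.
      by rewrite mulrBr mulrBl mulr1 [h * (k * k)]mulrA hk -[k * k * h]mulrA kh.
    apply: Pos_conj_sa; first exact: Pos_sa.
    by apply: PosM => //; [comm_ring|apply: PosD => //; exact: Pos1].
  have [l|l] := leP (T (h1 * h1)) (T (h2 * h2)).
    exists h1, m1; split=> //; rewrite exprS; lra.
  exists h2, m2; split=> //; rewrite exprS; lra.
have [n hn] : exists n, (2^-1 : R) ^+ n <= e.
  exists (Num.bound e^-1); set n := Num.bound _.
  rewrite exprVn invf_ple ?posrE ?exprn_gt0 //.
  have := archi_boundP (ltW (eqbRL (invr_gt0 e) e0)); rewrite -/n => h.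
  by rewrite (le_trans (ltW h)) // -natrX ler_nat ltnW // ltn_expl.
have [h [m [bhm Th]]] := H n; exists h, m; split=> //; exact: le_trans Th hn.
Qed.

End Bumps.

(** * Homomorphisms, quasitraces and subequivalence *)

Section StarHom.
Variables (R : realType) (A B : cstarAlgType R) (f : {lrmorphism A -> B}).
Hypothesis f_star : star_preserving f.

Lemma hom_rsc r : f (rsc A r) = rsc B r.
Proof. by rewrite /rsc linearZ /= rmorph1. Qed.

Lemma hom_Pos a : Pos a -> Pos (f a).
Proof.
move=> /Pos_positive[b ->]; apply/Pos_positive; exists (f b).
by rewrite rmorphM /= f_star.
Qed.

(** A homomorphism preserves [0 <= c <= nrm c]; take [c = a^* a]. *)
Lemma hom_nrm_le a : nrm (f a) <= nrm a.
Proof.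
rewrite -(@ler_pXn2r _ 2) ?nnegrE ?nrm_ge0 // -!nrm_starM -f_star -rmorphM.
set c := star a * a; have pc : Pos c by exact: star_mul_Pos.
apply: Pos_nrm_le; first exact: hom_Pos.
rewrite -hom_rsc -rmorphB; apply: hom_Pos.
by apply: Pos_sub_nrm => //; exact: Pos_sa.
Qed.

Lemma qtrace_comp (T : B -> R) : qtrace T -> qtrace (T \o f).
Proof.
move=> qT; split=> /=.
- by move=> x; rewrite !rmorphM /= !f_star (qt_tr qT).
- by move=> x; rewrite rmorphM /= f_star (qt_sq_ge0 qT).
- move=> a b sa sb ab; rewrite rmorphD (qtD qT) -?f_star ?sa ?sb //.
  by rewrite -!rmorphM ab.
- by move=> r a sa; rewrite rmorphM /= hom_rsc (qtZ qT) // -f_star sa.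
- by rewrite rmorph1 (qt1 qT).
Qed.

End StarHom.

Section QtraceOfQT.
Variables (R : realType) (B : cstarAlgType R).

(** The bicommutant of [a] and [b] is closed at once, and commutative because [a] and [b] lie in the
    commutant. It turns linearity on subalgebras into additivity on commuting pairs. *)
Lemma bicommutant_subalgebra (a b : B) : star a = a -> star b = b -> a * b = b * a ->
  exists S : set B, [/\ S a, S b &
    commutative_cstar_subalgebra (@star R B) *:%R closed S].
Proof.
move=> sa sb ab; exists [set x | forall z, z * a = a * z -> z * b = b * z -> z * x = x * z].
split=> /=; [by []|by []|split].
- apply: metric_closed => x hx z za zb; apply/eqP; rewrite -subr_eq0; apply/eqP.
  apply: nrm_eq0; apply/ler_addgt0Pr => e e0; rewrite add0r.
  have z1 : 0 < nrm z + nrm z + 1 by rewrite ltr_wpDl ?addr_ge0 ?nrm_ge0.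
  have [s Ss hs] := hx _ (divr_gt0 e0 z1).
  have -> : z * x - x * z = z * (x - s) - (x - s) * z + (z * s - s * z) by nc_ring.
  rewrite (Ss z za zb) subrr addr0 (le_trans (nrmD _ _)) // nrmN.
  rewrite (le_trans (lerD (nrmM _ _) (nrmM _ _))) // [nrm _ * nrm z]mulrC -mulrDl.
  rewrite (le_trans (ler_wpM2l _ hs)) ?addr_ge0 ?nrm_ge0 //.
  by rewrite mulrCA ger_pMr // ler_pdivrMr // mul1r lerDl.
- split=> [z _ _|x y hx hy z za zb]; first by rewrite mulr0 mul0r.
  by have h1 := hx z za zb; have h2 := hy z za zb; comm_ring.
- split=> [c x hx z za zb|x hx z za zb].
    by rewrite -scalerAr -scalerAl hx.
  have h : star z * x = x * star z.
    by apply: hx; rewrite -1?sa -1?sb -!starMr ?sa ?sb ?za ?zb.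
  by have := congr1 (@star R B) h; rewrite !starMr starK.
- by move=> x y hx hy z za zb; have h1 := hx z za zb; have h2 := hy z za zb; comm_ring.
- by move=> x y hx hy; apply: hy; apply/esym/hx.
Qed.

Lemma QT_qtrace tau : QT B tau -> qtrace (fun x => complex.Re (tau x)).
Proof.
move=> [[[t1 _ t3] _] tau1]; split.
- by move=> x; have [-> _] := t1 x.
- by move=> x; have [_] := t1 x; rewrite lecE => /andP[].
- move=> a b sa sb ab; have [S [Sa Sb cS]] := bicommutant_subalgebra sa sb ab.
  by rewrite -[in LHS](scale1r a) (t3 _ cS) // mul1r raddfD.
- move=> r a sa; have [S [Sa _ cS]] := bicommutant_subalgebra sa sa erefl.
  have S0 : S 0 by have [_ []] := cS.
  have tau0 : tau 0 = 0.
    have := t3 _ cS 1 0 0 S0 S0; rewrite scale1r addr0 mul1r => /eqP.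
    by rewrite -subr_eq0 opprD addrA subrr sub0r oppr_eq0 => /eqP.
  rewrite /rsc -scalerAl mul1r -[_ *: a]addr0 (t3 _ cS) // tau0 addr0.
  by case: (tau a) => u v; simpc.
- by rewrite tau1.
Qed.

End QtraceOfQT.

Section CuntzOne.
Variables (R : realType) (A : cstarAlgType R).

Lemma hnormE n (xi : 'cV[A]_n) :
  hnorm xi = Num.sqrt (nrm (\sum_i star (xi i 0) * xi i 0)).
Proof. by []. Qed.

Lemma nrm_entry_le n (xi : 'cV[A]_n) i : nrm (xi i 0) <= hnorm xi.
Proof.
rewrite hnormE -(ger0_norm (nrm_ge0 _)) -sqrtr_sqr ler_wsqrtr // -nrm_starM.
apply: Pos_le_nrm; first exact: star_mul_Pos.
rewrite (bigD1 i) //= addrAC subrr add0r.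
by apply: Pos_sum => j _; exact: star_mul_Pos.
Qed.

(** A crude bound, whose only purpose is the finiteness of the supremum in [mxnorm]. *)
Lemma hnorm_mul_le n (M : 'M[A]_n) (xi : 'cV[A]_n) : hnorm xi <= 1 ->
  hnorm (M *m xi) <= Num.sqrt (\sum_i (\sum_j nrm (M i j)) ^+ 2).
Proof.
move=> h; rewrite hnormE ler_wsqrtr //.
apply: (le_trans (y := \sum_i nrm (star ((M *m xi) i 0) * (M *m xi) i 0))).
  by elim/big_ind2: _ => [||//]; [rewrite nrm0|move=> x a y b ha hb;
    rewrite (le_trans (nrmD _ _)) // lerD].
apply: ler_sum => i _; rewrite nrm_starM lerXn2r ?nnegrE ?nrm_ge0 ?sumr_ge0 //.
  by move=> j _; exact: nrm_ge0.
rewrite mxE; elim/big_ind2: _ => [||j _]; first by rewrite nrm0.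
  by move=> x a y b ha hb; rewrite (le_trans (nrmD _ _)) // lerD.
rewrite (le_trans (nrmM _ _)) // ler_piMr ?nrm_ge0 //.
exact: le_trans (nrm_entry_le _ _) h.
Qed.

(* [sup] is [0] on unbounded sets, so boundedness has to be checked. *)
Lemma nrm_le_mxnorm n (M : 'M[A]_n) i : nrm (M i i) <= mxnorm M.
Proof.
pose e : 'cV[A]_n := \col_j (if j == i then 1 else 0).
have Me j : (M *m e) j 0 = M j i.
  rewrite mxE (bigD1 i) //= mxE eqxx mulr1 big1 ?addr0 // => k /negbTE ki.
  by rewrite mxE ki mulr0.
apply: (le_trans (y := hnorm (M *m e))); first by rewrite -Me nrm_entry_le.
apply: ub_le_sup.
  exists (Num.sqrt (\sum_i (\sum_j nrm (M i j)) ^+ 2)) => _ [xi /= h <-].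
  exact: hnorm_mul_le.
exists e => //=; rewrite hnormE (bigD1 i) //= mxE eqxx star1 mulr1 big1 ?addr0.
  by rewrite nrm1 sqrtr1.
by move=> j /negbTE ji; rewrite mxE ji mulr0.
Qed.

(** Padding puts [a] and [x] in the same corner entry. In that entry of [v x v^*] only the corner
    entry of [v] survives, and the matrix norm dominates the entry. *)
Lemma cuntz_le_one (a x : A) : cuntz_le (a%:M : 'M[A]_1) (x%:M : 'M[A]_1) ->
  forall e, 0 < e -> exists v, nrm (v * x * star v - a) <= e.
Proof.
move=> [k [v [hk hv]]] e e0.
have [N _ hN] := hv _ (@nbhsx_ballx _ _ (0 : R) _ e0).
have := hN N (leqnn N); rewrite -ball_normE /= sub0r normrN => h.
have [k1 _] := hk N; pose i : 'I_(k N) := Ordinal k1.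
exists (v N i i).
have padE (b : A) j l : pad (k N) (b%:M : 'M[A]_1) j l = if (j == i) && (l == i) then b else 0.
  rewrite mxE; case: insubP => [j' _ ej|]; last first.
    by rewrite -leqNgt; case: eqVneq => // ->.
  case: insubP => [l' _ el|]; last first.
    by rewrite -leqNgt andbC; case: eqVneq => // ->.
  have -> : j = i by apply: val_inj; rewrite -ej /= ord1.
  have -> : l = i by apply: val_inj; rewrite -el /= ord1.
  by rewrite !eqxx !ord1 mxE.
have := padE a i i; rewrite !eqxx /= => <-.
apply: le_trans (ltW h); apply: le_trans (ler_norm _).
have := nrm_le_mxnorm (v N *m pad (k N) (x%:M : 'M[A]_1) *m mxstar (v N)
  - pad (k N) (a%:M : 'M[A]_1)) i.
rewrite [X in nrm X]mxE [X in nrm (X + _)]mxE [X in nrm (_ + X)]mxE !padE eqxx /=.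
rewrite (bigD1 i) //= big1 ?addr0 => [|j /negbTE ji].
  rewrite mxE (bigD1 i) //= padE eqxx big1 ?addr0 => [|j /negbTE ji]; first by rewrite !mxE.
  by rewrite padE ji mulr0.
rewrite mxE big1 ?mul0r // => l _; by rewrite padE ji andbF mulr0.
Qed.

End CuntzOne.

(** * The averaging projection *)

(** In the application [a = T (e p e) = T (p e^2 p)], [b = T (p F p)], [t = T (e^2)], [tF = T F] and
    [tp = T p]. The error collects [eta] from [tp - b], [3 n eps] from [b - t], [2 eps] from
    [t - tF / n] and [eta] from [1 - tF]. *)
Lemma avg_estimate (R : realFieldType) (n eps eta a b t tF tp : R) :
  1 <= n -> 0 <= eps ->
  a <= n^-1 * t + eps -> n^-1 * t <= a + eps ->
  a <= n^-1 * b + (eps + eps) -> n^-1 * b <= a + (eps + eps) ->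
  tF <= n * (t + (eps + eps)) -> n * (t - (eps + eps)) <= tF ->
  0 <= 1 - tF <= eta -> 0 <= tp - b <= eta ->
  `|tp - n^-1| <= eta + eta + 5 * n * eps.
Proof.
move=> n1 eps0 A1 A2 B1 B2 C1 C2 /andP[E1 E2] /andP[P1 P2].
have n0 : 0 < n by apply: lt_le_trans n1.
have nn : n * n^-1 = 1 by rewrite divff // lt0r_neq0.
have in1 : n^-1 <= 1 by rewrite invf_le1.
have in0 : 0 <= n^-1 by rewrite invr_ge0 ltW.
move: A1 A2 B1 B2 C1 C2; rewrite -!(ler_pM2l n0 a) -!(ler_pM2l n0 _ (a + _)).
rewrite !mulrDr !mulrN !mulrDr !mulrA nn !mul1r => X3 X4 X1 X2 C1 C2.
have Y1 := ler_wpM2l in0 C1; have Y2 := ler_wpM2l in0 C2.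
rewrite !mulrDr !mulrN !mulrDr !mulrA mulVf ?lt0r_neq0 // !mul1r in Y1 Y2.
have Z1 : n^-1 * tF <= n^-1 * 1 by rewrite ler_wpM2l // -subr_ge0.
have Z2 : n^-1 * (1 - eta) <= n^-1 * tF by rewrite ler_wpM2l //; lra.
have eta0 : 0 <= eta by lra.
have W1 : n^-1 * eta <= eta by rewrite ler_piMl.
have W2 : eps <= n * eps by rewrite ler_peMl.
rewrite mulrBr mulr1 in Z2; rewrite mulr1 in Z1.
rewrite -mulrA ler_norml; apply/andP; split; lra.
Qed.

Section Averaging.
Variables (R : realType) (G : finGroupType) (B : cstarAlgType R) (w : G -> B).
Hypotheses (w_unitary : forall g, unitary (w g))
           (wM : forall g h, w (g * h)%g = w g * w h).
Local Notation rsc := (rsc B).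
Let n : R := #|G|%:R.

Lemma rep1 : w 1%g = 1.
Proof.
have [h _] := w_unitary 1%g.
by rewrite -[LHS]mul1r -h -mulrA -wM mulg1.
Qed.

Lemma rep_star g : star (w g) = w g^-1%g.
Proof.
have [_ h] := w_unitary g.
by rewrite -[LHS]mul1r -rep1 -(mulVg g) wM -mulrA h mulr1.
Qed.

Lemma nrm_rep g : nrm (w g) = 1.
Proof.
have [h _] := w_unitary g; apply/eqP.
by rewrite -(@eqrXn2 _ 2) ?nrm_ge0 // -nrm_starM h nrm1 expr1n.
Qed.

Lemma card_gt0 : 0 < n.
Proof. by rewrite ltr0n; apply/card_gt0P; exists 1%g. Qed.

Lemma rsc_natM k x : rsc k%:R * x = x *+ k.
Proof. by rewrite /rsc -scalerAl mul1r rmorph_nat scaler_nat. Qed.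

Lemma rsc_card_inv x : rsc n^-1 * (x *+ #|G|) = x.
Proof.
by rewrite -rsc_natM mulrA -rscM mulVf ?rsc1 ?mul1r // lt0r_neq0 // card_gt0.
Qed.

Definition avg : B := rsc n^-1 * \sum_g w g.

Lemma rep_avg g : w g * avg = avg.
Proof.
rewrite /avg mulrA -rscC -mulrA; congr (_ * _); rewrite mulr_sumr.
rewrite [RHS](reindex_inj (mulgI g)) /=.
by apply: eq_bigr => h _; rewrite wM.
Qed.

Lemma avg_sa : star avg = avg.
Proof.
rewrite /avg starMr star_rsc star_sum -rscC; congr (_ * _).
rewrite [RHS](reindex_inj invg_inj) /=.
by apply: eq_bigr => h _; rewrite rep_star.
Qed.

Lemma avg_rep g : avg * star (w g) = avg.
Proof. by rewrite -{1}avg_sa -starMr rep_avg avg_sa. Qed.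

Lemma avg_rep' g : avg * w g = avg.
Proof. by rewrite -[w g]starK rep_star avg_rep. Qed.

Lemma avg_idem : avg * avg = avg.
Proof.
rewrite {1}/avg -mulrA mulr_suml (eq_bigr (fun=> avg)) => [|g _]; last exact: rep_avg.
by rewrite sumr_const rsc_card_inv.
Qed.

Lemma nrm_avg_sum (F : G -> B) e : (forall g, nrm (F g) <= e) ->
  nrm (rsc n^-1 * \sum_g F g) <= e.
Proof.
move=> hF; have n0 := card_gt0.
rewrite (le_trans (nrmM _ _)) // nrm_rsc ger0_norm ?invr_ge0 ?(ltW n0) //.
rewrite ler_pdivrMl // mulr_natl -sumr_const.
elim/big_ind2: _ => [||g _]; [by rewrite nrm0| |exact: hF].
by move=> x a y b ha hb; rewrite (le_trans (nrmD _ _)) // lerD.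
Qed.

Lemma nrm_avg : nrm avg <= 1.
Proof. by apply: nrm_avg_sum => g; rewrite nrm_rep. Qed.

Lemma nrm_mul_le1 (x y : B) e : nrm x <= 1 -> nrm y <= e -> nrm (x * y) <= e.
Proof.
move=> h1 h2; rewrite (le_trans (nrmM _ _)) // (le_trans _ h2) //.
by rewrite ler_piMl ?nrm_ge0.
Qed.

Lemma nrm_mulr_le1 (x y : B) e : nrm x <= 1 -> nrm y <= e -> nrm (y * x) <= e.
Proof.
move=> h1 h2; rewrite (le_trans (nrmM _ _)) // (le_trans _ h2) //.
by rewrite ler_piMr ?nrm_ge0.
Qed.

Variable T : B -> R.
Hypothesis qT : qtrace T.

Lemma qt_sum (F : G -> B) : (forall g, star (F g) = F g) ->
  (forall g h, F g * F h = F h * F g) -> T (\sum_g F g) = \sum_g T (F g).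
Proof.
move=> sF cF.
elim: (index_enum G) => [|g l IH]; first by rewrite !big_nil -(rsc0 B) (qt_rsc qT).
rewrite !big_cons (qtD qT) ?IH //.
  by rewrite star_sum; apply: eq_bigr => h _; exact: sF.
by apply: commr_sum => h _; exact: cF.
Qed.

Lemma qt_avg (f : G -> B) eps eta (F := \sum_g f g * f g) :
  (forall g, star (f g) = f g) -> (forall g, nrm (f g) <= 1) ->
  (forall g h, g != h -> f g * f h = 0) ->
  (forall g, nrm (w g * f 1%g * star (w g) - f g) <= eps) ->
  0 <= T (1 - F) <= eta -> 0 <= T (avg * (1 - F) * avg) <= eta ->
  `|T avg - n^-1| <= eta + eta + 5 * n * eps.
Proof.
move=> sf f1 fo fw /andP[E1 E2] /andP[P1 P2].
have n0 := card_gt0.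
set p := avg in P1 P2 *; have sp : star p = p := avg_sa; have pp : p * p = p := avg_idem.
set e := f 1%g; have se : star e = e := sf _.
(* The exact translates of [e]: close to [f g], and with squares of the same trace as [e^2]. *)
pose c g := w g * e * star (w g).
have sc g : star (c g) = c g by rewrite /c !starMr starK se mulrA.
have ww g : star (w g) * w g = 1 by have [] := w_unitary g.
have cc g : c g * c g = w g * (e * e) * star (w g).
  have -> : c g * c g = w g * e * (star (w g) * w g) * e * star (w g) by rewrite /c; nc_ring.
  by rewrite ww mulr1; nc_ring.
have nc g : nrm (c g) <= 1.
  rewrite /c; apply: nrm_mulr_le1; first by rewrite nrm_star nrm_rep.
  by apply: nrm_mul_le1; [rewrite nrm_rep|exact: f1].
have ccff g : nrm (c g * c g - f g * f g) <= eps + eps.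
  have -> : c g * c g - f g * f g = c g * (c g - f g) + (c g - f g) * f g by nc_ring.
  rewrite (le_trans (nrmD _ _)) // lerD //.
    exact: nrm_mul_le1 (nc g) (fw g).
  exact: nrm_mulr_le1 (f1 g) (fw g).
have sff g : star (f g * f g) = f g * f g by rewrite starMr sf.
have sF : star F = F by rewrite star_sum; apply: eq_bigr => g _.
have eps0 : 0 <= eps by apply: le_trans (fw 1%g); exact: nrm_ge0.
have hA : nrm (e * p * e - rsc n^-1 * (e * e)) <= eps.
  have -> : e * p * e - rsc n^-1 * (e * e) =
     rsc n^-1 * \sum_g (if g == 1%g then 0 else e * w g * e).
    have -> : e * p * e = rsc n^-1 * \sum_g e * w g * e.
      by rewrite /p /avg mulrA -rscC -!mulrA mulr_suml mulr_sumr; congr (_ * _);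
        apply: eq_bigr => g _; rewrite mulrA.
    rewrite -mulrBr; congr (_ * _).
    rewrite [in LHS](bigD1 1%g) //= rep1 mulr1 addrAC subrr add0r.
    rewrite [in RHS](bigD1 1%g) //= eqxx add0r.
    by apply: eq_bigr => g /negbTE ->.
  apply: nrm_avg_sum => g; case: eqVneq => [_|g1]; first by rewrite nrm0.
  (* Here [c_g w_g = w_g e] and [e f_g = 0] for [g] other than 1. *)
  have -> : e * w g * e = e * (c g - f g) * w g.
    rewrite mulrBr fo 1?eq_sym // subr0 /c.
    have -> : e * (w g * e * star (w g)) * w g = e * w g * e * (star (w g) * w g) by nc_ring.
    by rewrite ww mulr1.
  apply: nrm_mulr_le1; first by rewrite nrm_rep.
  exact: nrm_mul_le1 (f1 _) (fw g).
(* As [p] absorbs the unitaries, [p e^2 p = p c_g^2 p] for every [g]; replace each [c_g^2] by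
   [f_g^2] and average. *)
have hB : nrm (p * (e * e) * p - rsc n^-1 * (p * F * p)) <= eps + eps.
  have -> : p * (e * e) * p - rsc n^-1 * (p * F * p) =
     rsc n^-1 * \sum_g p * (c g * c g - f g * f g) * p.
    have -> : \sum_g p * (c g * c g - f g * f g) * p = (p * (e * e) * p) *+ #|G| - p * F * p.
      rewrite -sumr_const /F mulr_sumr mulr_suml -sumrB; apply: eq_bigr => g _.
      have wp : star (w g) * p = p by rewrite rep_star rep_avg.
      rewrite mulrBr mulrBl cc; congr (_ - _).
      have -> : p * (w g * (e * e) * star (w g)) * p = p * w g * (e * e) * (star (w g) * p) by nc_ring.
      by rewrite wp avg_rep'.
    by rewrite mulrBr rsc_card_inv.
  apply: nrm_avg_sum => g; apply: nrm_mulr_le1; first exact: nrm_avg.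
  by apply: nrm_mul_le1; first exact: nrm_avg.
have TA : T (e * p * e) = T (p * (e * e) * p).
  have -> : e * p * e = star (p * e) * (p * e) by rewrite starMr se sp -{1}pp; nc_ring.
  rewrite (qt_tr qT) starMr se sp; congr T; nc_ring.
have see : star (e * e) = e * e by rewrite starMr se.
have s3 (x y : B) : star x = x -> star y = y -> star (x * y * x) = x * y * x.
  by move=> sx sy; rewrite !starMr sx sy mulrA.
have sA : star (e * p * e) = e * p * e by exact: s3.
have sB : star (p * (e * e) * p) = p * (e * e) * p by exact: s3.
have sC : star (p * F * p) = p * F * p by exact: s3.
have sn x : star x = x -> star (rsc n^-1 * x) = rsc n^-1 * x.
  by move=> sx; rewrite starMr star_rsc sx rscC.
have A1 := qt_dist qT sA (sn _ see) hA.
have A2 : T (rsc n^-1 * (e * e)) <= T (e * p * e) + eps.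
  by apply: (qt_dist qT) => //; [exact: sn|rewrite nrm_subC].
have B1 := qt_dist qT sB (sn _ sC) hB.
have B2 : T (rsc n^-1 * (p * F * p)) <= T (p * (e * e) * p) + (eps + eps).
  by apply: (qt_dist qT) => //; [exact: sn|rewrite nrm_subC].
rewrite !(qtZ qT) // in A1 A2 B1 B2.
have Tcc g : T (c g * c g) = T (e * e).
  have -> : c g * c g = star (e * star (w g)) * (e * star (w g)).
    by rewrite cc starMr starK se; nc_ring.
  rewrite (qt_tr qT) starMr starK se.
  have -> : e * star (w g) * (w g * e) = e * (star (w g) * w g) * e by nc_ring.
  by rewrite ww mulr1.
have scc g : star (c g * c g) = c g * c g by rewrite starMr sc.
have TF : T F = \sum_g T (f g * f g).
  apply: qt_sum => // g h; case: (eqVneq g h) => [->//|gh].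
  have hg : h != g by rewrite eq_sym.
  by rewrite -!mulrA ![f g * (f h * _)]mulrA ![f h * (f g * _)]mulrA !fo // !mul0r !mulr0.
have C1 : T F <= n * (T (e * e) + (eps + eps)).
  rewrite TF mulr_natl -sumr_const; apply: ler_sum => g _.
  by rewrite -(Tcc g); apply: (qt_dist qT) => //; rewrite nrm_subC.
have C2 : n * (T (e * e) - (eps + eps)) <= T F.
  rewrite TF mulr_natl -sumr_const; apply: ler_sum => g _.
  by rewrite lerBlDr -(Tcc g); apply: (qt_dist qT).
have D1 : T p = T (p * F * p) + T (p * (1 - F) * p).
  rewrite -(qtD qT) //.
  - congr T; have -> : p * F * p + p * (1 - F) * p = p * p by nc_ring.
    by rewrite pp.
  - by apply: s3; rewrite // starB star1 sF.
  have -> : p * (1 - F) * p = p - p * F * p.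
    by rewrite mulrBr mulrBl mulr1 pp.
  have cp : p * F * p * p = p * (p * F * p).
    have -> : p * F * p * p = p * F * (p * p) by nc_ring.
    have -> : p * (p * F * p) = p * p * F * p by nc_ring.
    by rewrite pp.
  rewrite mulrBr mulrBl cp //.
have D2 : T (1 - F) = 1 - T F.
  by rewrite (qtB qT) ?star1 ?mul1r ?mulr1 ?(qt1 qT).
rewrite TA in A1 A2; rewrite D2 in E1 E2.
apply: (avg_estimate _ eps0 A1 A2 B1 B2 C1 C2); rewrite ?E1 ?E2 //.
  by rewrite ler1n; apply/card_gt0P; exists 1%g.
by rewrite D1 addrC addKr P1 P2.
Qed.

End Averaging.

(** * The trace of the remainder, and the conclusion *)

Section SmallRemainder.
Variables (R : realType) (A : cstarAlgType R) (T : A -> R).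
Hypothesis qT : qtrace T.
Local Notation rsc := (rsc A).

(** First [1 - f^2 <= 2 (1 - f)], the difference being [(1 - f)^2]. Next, [q (1 - f) q] is within
    [eps] of [z^* z] for [z = m v^* q], which has [h] as a left unit, so [qt_le_unit] applies; the
    inner factor 2 bounds [nrm (z^* z) <= 1 + eps]. *)
Lemma remainder_le (q f v h m : A) eps : star q = q -> nrm q <= 1 ->
  0 <= eps <= 1 -> Pos f -> Pos (1 - f) -> star h = h -> star m = m -> h * m = m ->
  nrm (v * (m * m) * star v - (1 - f)) <= eps ->
  0 <= T (q * (1 - f * f) * q) <= 2 * (2 * T (h * h) + eps).
Proof.
move=> sq q1 /andP[eps0 eps1] pf pf1 sh sm hm hv.
have sf := Pos_sa pf; have sf1 := Pos_sa pf1.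
have pff : Pos (1 - f * f).
  have -> : 1 - f * f = (1 - f) * (1 + f) by nc_ring.
  by apply: PosM => //; [comm_ring|apply: PosD => //; exact: Pos1].
have pqq : Pos (q * (1 - f * f) * q) by exact: Pos_conj_sa.
apply/andP; split; first exact: (qt_ge0 qT).
have sqf : star (q * (1 - f) * q) = q * (1 - f) * q by rewrite !starMr sq sf1 mulrA.
have le1 : T (q * (1 - f * f) * q) <= 2 * T (q * (1 - f) * q).
  rewrite -(qtZ qT) //; apply: (qt_le_Pos qT) => //.
  have -> : rsc 2 * (q * (1 - f) * q) - q * (1 - f * f) * q = q * ((1 - f) * (1 - f)) * q.
    have -> : rsc 2 = 1 + 1 by rewrite -(rsc1 A) -rscD.
    nc_ring.
  by apply: Pos_conj_sa => //; exact: Pos_sq.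
pose z := m * star v * q.
have zz : star z * z = q * (v * (m * m) * star v) * q.
  by rewrite /z !starMr starK sm sq; nc_ring.
have pzz : Pos (star z * z) by exact: star_mul_Pos.
have close : nrm (q * (1 - f) * q - star z * z) <= eps.
  have -> : q * (1 - f) * q - star z * z = q * ((1 - f) - v * (m * m) * star v) * q.
    by rewrite zz; nc_ring.
  by apply: nrm_mulr_le1 => //; apply: nrm_mul_le1 => //; rewrite nrm_subC.
have le2 : T (q * (1 - f) * q) <= T (star z * z) + eps.
  by apply: (qt_dist qT) => //; exact: Pos_sa.
have hz : h * z = z by rewrite /z !mulrA hm.
have p0 : Pos (star z * z - star z * z) by rewrite subrr; exact: Pos0.
have le3 := qt_le_unit qT pzz p0 sh hz.
have nf : nrm (1 - f) <= 1.
  by apply: Pos_nrm_le => //; rewrite rsc1; have -> : 1 - (1 - f) = f by nc_ring.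
have nzz : nrm (star z * z) <= 2.
  have -> : star z * z = q * (1 - f) * q - (q * (1 - f) * q - star z * z) by nc_ring.
  rewrite (le_trans (nrmD _ _)) // nrmN.
  have : nrm (q * (1 - f) * q) <= 1 by apply: nrm_mulr_le1 => //; exact: nrm_mul_le1.
  lra.
have Th : 0 <= T (h * h) by apply: (qt_ge0 qT); exact: Pos_sq.
have := ler_wpM2r Th nzz; lra.
Qed.

End SmallRemainder.

Lemma bump_normalize (R : realType) (A : cstarAlgType R) (h m : A) : bump_pair h m ->
  exists2 m', bump_pair h m' & nrm (m' * m') = 1.
Proof.
move=> [ph ph1 sm m0 hm].
have nm : 0 < nrm m by rewrite ltNge; apply/negP => /nrm_eq0.
pose m' := rsc A (nrm m)^-1 * m.
have sm' : star m' = m' by rewrite /m' starMr star_rsc sm rscC.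
have nm' : nrm m' = 1.
  rewrite /m' /rsc -scalerAl mul1r nrmZ ger0_norm ?invr_ge0 ?nrm_ge0 //.
  by rewrite mulVf // lt0r_neq0.
exists m'; last by rewrite nrm_sa // nm' expr1n.
split=> //; first by move=> e; move: nm'; rewrite e nrm0 => /eqP; rewrite eq_sym oner_eq0.
by rewrite /m' mulrA -rscC -mulrA hm.
Qed.

Unset Implicit Arguments.
Set Strict Implicit.
Set Printing Implicit Defensive.

Theorem lemma4p4 (R : realType) (G : finGroupType) (A : cstarAlgType R)
    (alpha : G -> {lrmorphism A -> A})
    (B : cstarAlgType R) (iota : {lrmorphism A -> B}) (u : G -> B)
    (tau : B -> R[i]) :
  infinite_dimensional A -> stably_finite A -> simple_cstar A ->
  cstar_action alpha -> weak_tracial_Rokhlin alpha ->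
  is_crossed_product alpha iota u ->
  QT B tau ->
  let p : B := (#|G|%:R : R[i])^-1 *: \sum_(g : G) u g in
  tau p = (#|G|%:R)^-1.
Proof.
move=> infA _ simpA _ wtr [[iota_star u_unit uM u_cov] _ _] qtau p.
have qT := QT_qtrace qtau; set T := fun x => complex.Re (tau x) in qT.
(* Simplicity is known for [A], so the small bump is sought there, for the quasitrace pulled back
   along [iota]. *)
have qTA := qtrace_comp iota_star qT.
pose n : R := #|G|%:R.
have nC : (#|G|%:R : R[i])^-1 = (n^-1)%:C by rewrite /n -(rmorph_nat (real_complex R)) -fmorphV.
have pE : p = avg u by rewrite /p /avg nC -/n rscE.
(* Since [p = p^* p], the value [tau p] is nonnegative, hence real. *)
have tau_p : tau p = (T p)%:C.
  rewrite /T RRe_real // ger0_real // pE -(avg_idem uM) -{1}(avg_sa u_unit uM).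
  by have [[[t1 _ _] _] _] := qtau; have [_] := t1 (avg u).
rewrite tau_p nC pE; congr (_%:C); apply/eqP; rewrite -subr_eq0 -normr_le0.
apply/ler_addgt0Pr => d d0; rewrite add0r.
have n0 : 0 < n := card_gt0 R G.
(* The final error is [2 eta + 5 n eps] with [eta = 6 eps], that is [(12 + 5 n) eps]; [remainder_le]
   asks for [eps <= 1]. *)
pose eps := Num.min 1 (d / (4 + 5 * n + 8)).
have c0 : 0 < 4 + 5 * n + 8 by rewrite !addr_gt0 ?mulr_gt0.
have eps0 : 0 < eps by rewrite lt_min ltr01 divr_gt0.
have eps1 : eps <= 1 by rewrite ge_min lexx.
have epsd : eps * (4 + 5 * n + 8) <= d by rewrite -ler_pdivlMr // ge_min lexx orbT.
have [h [m0 [bhm0 Th]]] := small_bump qTA simpA infA eps0.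
have [m bhm nmm] := bump_normalize bhm0; have [ph _ sm _ hm] := bhm.
have [f_ [[f_pos f_orth] [_ f_alpha f_cuntz _]]] :=
  wtr eps set0 (m * m) eps0 (finite_set0 _) ltac:(by exists m; rewrite sm) ltac:(by rewrite nrmE nmm).
set f := \sum_g f_ g in f_cuntz.
have pf g : Pos (f_ g) by apply/Pos_positive; have [] := f_pos g.
have cz := cuntz_le_one f_cuntz.
(* Subequivalence presents [1 - f] as a limit of positive elements [v m^2 v^*]. *)
have pf1 : Pos (1 - f).
  apply: Pos_closed => e /cz[v hv]; exists (v * (m * m) * star v); last by rewrite nrm_subC.
  by apply: Pos_conj'; exact: Pos_sq.
have pff : Pos f by apply: Pos_sum => g _; exact: pf.
have [v hv] := cz _ eps0.
have ff : f * f = \sum_g f_ g * f_ g.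
  rewrite {1}/f mulr_suml; apply: eq_bigr => g _; rewrite /f mulr_sumr (bigD1 g) //=.
  by rewrite big1 ?addr0 // => k kg; apply: f_orth; rewrite eq_sym.
pose f' g := iota (f_ g).
have ff' : \sum_g f' g * f' g = iota f * iota f.
  by rewrite -rmorphM ff rmorph_sum; apply: eq_bigr => g _; rewrite rmorphM.
(* Taken at [q = 1] and at the averaging projection, this yields the two smallness conditions of
   [qt_avg]. *)
have rem q : star q = q -> nrm q <= 1 ->
    0 <= T (q * (1 - iota f * iota f) * q) <= 2 * (2 * T (iota h * iota h) + eps).
  move=> sq q1; apply: (@remainder_le _ _ _ qT q (iota f) (iota v) (iota h) (iota m)) => //.
  - by rewrite (ltW eps0).
  - exact: hom_Pos.
  - by rewrite -(rmorph1 iota) -rmorphB; exact: hom_Pos.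
  - by rewrite -iota_star Pos_sa.
  - by rewrite -iota_star sm.
  - by rewrite -rmorphM hm.
  - rewrite -iota_star -!rmorphM -(rmorph1 iota) -!rmorphB.
    by apply: le_trans hv; exact: hom_nrm_le.
have Thb : T (iota h * iota h) <= eps by rewrite -rmorphM.
pose eta := 2 * (2 * eps + eps).
have mono q : 0 <= T q <= 2 * (2 * T (iota h * iota h) + eps) -> 0 <= T q <= eta.
  by move=> /andP[-> hq]; rewrite /= (le_trans hq) // /eta; lra.
have := @qt_avg R G B u u_unit uM T qT f' eps eta.
rewrite ff' => /(_ _ _ _ _ _ _) H.
apply: le_trans (H _ _ _ _ _ _) _.
- by move=> g; rewrite /f' -iota_star Pos_sa.
- move=> g; apply: le_trans (hom_nrm_le iota_star _) _.
  by have [_] := f_pos g; rewrite nrmE lecR.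
- by move=> g k gk; rewrite /f' -rmorphM f_orth // rmorph0.
- move=> g; rewrite /f' u_cov -rmorphB; apply: le_trans (hom_nrm_le iota_star _) _.
  by have := f_alpha g 1%g; rewrite mulg1 nrmE ltcR => /ltW.
- by apply: mono; have := rem 1 (star1 B); rewrite !mul1r !mulr1; apply; rewrite nrm1.
- by apply: mono; apply: rem; [exact: avg_sa|exact: nrm_avg].
by rewrite /eta -/n; lra.
Qed.
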